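(* Let $T>0$. Let $q$ and $u_0$ be distributions on $(0,1)$ with $q\ge0$, let $a$ be a distribution on $[0,T]$, and suppose there exists $a_0>0$ such that $a\ge a_0>0$ in the sense that $\langle a-a_0,\phi\rangle\ge0$ for any test function $\phi\ge0$. Then the very weak solution to the initial/boundary value problem $$\begin{cases} i\partial_t u(t,x)+a(t)\left(-\partial_x^2u(t,x)+q(x)u(t,x)\right)=0, & (t,x)\in[0,T]\times(0,1),\\ u(0,x)=u_0(x), & x\in(0,1),\\ u(t,0)=0=u(t,1), & t\in[0,T],\end{cases}$$ is unique.
   Context: Nets are indexed by $\varepsilon\in(0,1]$. Moderateness. A net $(u_\varepsilon(t,x))$ is uniformly $L^2$-moderate if there exist $N\in\mathbb{N}_0$, $C>0$ with $\|u_\varepsilon(t,\cdot)\|_{L^2}\le C\varepsilon^{-N}$ for all $t\in[0,T]$. A net $(u_{0,\varepsilon}(x))$ is $H^2$-moderate if there exist $N\in\mathbb{N}_0$, $C>0$ with $\|u_{0,\varepsilon}\|_{L^2}\le C\varepsilon^{-N}$ and $\|u_{0,\varepsilon}''\|_{L^2}\le C\varepsilon^{-N}$. Nets $(q_\varepsilon(x))$, respectively $(a_\varepsilon(t))$, are $L^\infty$-moderate if there exist $N\in\mathbb{N}_0$, $C>0$ with $\|q_\varepsilon\|_{L^\infty(0,1)}\le C\varepsilon^{-N}$, respectively $\|a_\varepsilon\|_{L^\infty[0,T]}\le C\varepsilon^{-N}$. Regularisation. A regularisation of a distribution is a net of smooth functions approximating it as $\varepsilon\to0$, for example obtained by convolution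 with a Friedrichs mollifier $\psi_\varepsilon(x)=\varepsilon^{-1}\psi(x/\varepsilon)$, $\psi\in C_0^\infty(\mathbb{R})$, $\int\psi=1$. Very weak solution. A net $(u_\varepsilon)_{\varepsilon>0}$ is a very weak solution of the initial/boundary value problem $$\begin{cases} i\partial_t u(t,x)+a(t)\left(-\partial_x^2u(t,x)+q(x)u(t,x)\right)=0, & (t,x)\in[0,T]\times(0,1),\\ u(0,x)=u_0(x), & x\in(0,1),\\ u(t,0)=0=u(t,1), & t\in[0,T],\end{cases}$$ if there exist an $L^\infty$-moderate regularisation $q_\varepsilon$ of $q$, an $L^\infty$-moderate regularisation $a_\varepsilon$ of $a$, and an $H^2$-moderate regularisation $u_{0,\varepsilon}$ of $u_0$ such that, for every $\varepsilon$, $u_\varepsilon$ solves the regularised problem $$\begin{cases} i\partial_t u_\varepsilon+a_\varepsilon(t)\left(-\partial_x^2u_\varepsilon+q_\varepsilon(x)u_\varepsilon\right)=0, & (t,x)\in[0,T]\times(0,1),\\ u_\varepsilon(0,x)=u_{0,\varepsilon}(x), & x\in(0,1),\\ u_\varepsilon(t,0)=0=u_\varepsilon(t,1), & t\in[0,T],\end{cases}$$ and $(u_\varepsilon)$ and $(\partial_t u_\varepsilon)$ are uniformly $L^2$-moderate. Solutions of the regularised problem are taken in $C([0,T];L^2(0,1))$. Negligibility. A difference $(u_\varepsilon-\tilde u_\varepsilon)$ of two nets in $L^2(0,1)$ is $L^2$-negligible if for every $N\in\mathbb{N}$ there exists $C>0$ (possibly depending on $N$ but not on $\varepsilon$) with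 $\|u_\varepsilon-\tilde u_\varepsilon\|_{L^2}\le C\varepsilon^N$ for all $\varepsilon\in(0,1]$; for nets depending on $t\in[0,T]$ it is uniformly $L^2$-negligible if $\|u_\varepsilon(t,\cdot)-\tilde u_\varepsilon(t,\cdot)\|_{L^2}\le C\varepsilon^N$ uniformly in $t\in[0,T]$. $L^\infty$-negligibility is defined in the same way with the $L^\infty$-norm (on $(0,1)$ for nets in $x$, on $[0,T]$ for nets in $t$), and $(u_{0,\varepsilon}-\tilde u_{0,\varepsilon})$ is $H^2$-negligible if both it and its second derivative in $x$ are $L^2$-negligible. Uniqueness. The problem has a unique very weak solution if for all $L^\infty$-moderate nets $q_\varepsilon,\tilde q_\varepsilon$ such that $(q_\varepsilon-\tilde q_\varepsilon)$ is $L^\infty$-negligible, for all $L^\infty$-moderate nets $a_\varepsilon,\tilde a_\varepsilon$ such that $(a_\varepsilon-\tilde a_\varepsilon)$ is $L^\infty$-negligible, and for all $H^2$-moderate regularisations $u_{0,\varepsilon},\tilde u_{0,\varepsilon}$ such that $(u_{0,\varepsilon}-\tilde u_{0,\varepsilon})$ is $H^2$-negligible, the difference $u_\varepsilon-\tilde u_\varepsilon$ is uniformly $L^2$-negligible. Here $u_\varepsilon$ solves the regularised problem with data $(q_\varepsilon,a_\varepsilon,u_{0,\varepsilon})$ and $\tilde u_\varepsilon$ solves the regularised problem with data $(\tilde q_\varepsilon,\tilde a_\varepsilon,\tilde u_{0,\varepsilon})$; the nets $q_\varepsilon,\tilde q_\varepsilon$, $a_\varepsilon,\tilde a_\varepsilon$,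 $u_{0,\varepsilon},\tilde u_{0,\varepsilon}$ are those regularising $q$, $a$, $u_0$. *)

(* Defs.v *)
From HB Require Import structures.
From mathcomp Require Import all_boot all_order all_algebra.
From mathcomp Require Import complex.
From mathcomp Require Import all_classical all_reals all_analysis.

Set Implicit Arguments.
Unset Strict Implicit.
Unset Printing Implicit Defensive.
Import Order.TTheory GRing.Theory Num.Theory.
Import numFieldNormedType.Exports.

Local Open Scope classical_set_scope.
Local Open Scope ring_scope.
Local Open Scope complex_scope.

Section Distributions.
Context {R : realType}.
Implicit Types (I : set R) (f phi : R -> R).

(* [A] need not be open: smooth up to the boundary points belonging to [A],
   i.e. [f] agrees on [A] with a function smooth on a neighbourhood of [A]. *)
Definition smooth_on (A : set R) f : Prop :=
  exists g : R -> R, exists U : set R,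
    [/\ open U, A `<=` U, (forall x, A x -> f x = g x) &
        forall n x, U x -> derivable (derive1n n g) x 1].

Definition test_function_in (K : set R) phi : Prop :=
  smooth_on setT phi /\ (forall x, ~ K x -> phi x = 0).

(* For closed [I] the support may touch the end points of [I]. *)
Definition test_function I phi : Prop :=
  exists K : set R, [/\ compact K, K `<=` I & test_function_in K phi].

(* Real distributions on [I].  The last field is continuity with respect to
   the seminorms max_(k <= m) sup |phi^(k)|; the values of [dist_fun] outside
   the test functions on [I] are irrelevant. *)
Record schwartz_distribution I := SchwartzDistribution {
  dist_fun :> (R -> R) -> R ;
  dist_linear : forall (c : R) phi psi,
    test_function I phi -> test_function I psi ->
    dist_fun (fun x => c * phi x + psi x) = c * dist_fun phi + dist_fun psi ;
  dist_continuous : forall K : set R, compact K -> K `<=` I ->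
    exists C : R, exists m : nat, forall phi (M : R),
      test_function_in K phi ->
      (forall k x, (k <= m)%N -> `|derive1n k phi x| <= M) ->
      `|dist_fun phi| <= C * M }.

(* A complex distribution, given by its real and imaginary parts. *)
Definition complex_schwartz_distribution I : Type := (schwartz_distribution I * schwartz_distribution I)%type.

Definition dist_ge I (d : schwartz_distribution I) (c : R) : Prop :=
  forall phi, test_function I phi -> (forall x, 0 <= phi x) ->
    0 <= d phi - \int[lebesgue_measure]_(x in I) (c * phi x).

(* Nets are indexed by eps in ]0, 1]; values at other eps are irrelevant. *)
Definition regularisation I (d : schwartz_distribution I) (f : R -> R -> R) : Prop :=
  (forall eps : R, 0 < eps <= 1 -> smooth_on I (f eps)) /\
  (forall phi, test_function I phi ->
     (\int[lebesgue_measure]_(x in I) (f eps x * phi x)) @[eps --> 0^'+]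
       --> d phi).

Definition cregularisation I (d : complex_schwartz_distribution I) (f : R -> R -> R[i]) : Prop :=
  regularisation d.1 (fun eps x => complex.Re (f eps x)) /\
  regularisation d.2 (fun eps x => complex.Im (f eps x)).

End Distributions.

Section Norms.
Context {R : realType}.

Definition cabs (z : R[i]) : R := complex.Re `|z|.

(* Extending by 0 outside [A] turns the library's norm into the norm of
   L^p(A). *)
Definition Lnorm_on (p : \bar R) (A : set R) (f : R -> R) : \bar R :=
  Lnorm lebesgue_measure p (EFin \o (f \_ A)).

Definition Linfty_norm (A : set R) (f : R -> R) : \bar R :=
  Lnorm_on +oo%E A f.

Definition L2norm (f : R -> R[i]) : \bar R :=
  Lnorm_on 2%:E `]0, 1[ (fun x => cabs (f x)).

Definition inL2 (f : R -> R[i]) : Prop :=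
  [/\ measurable_fun (`]0, 1[ : set R) (fun x => complex.Re (f x)),
      measurable_fun (`]0, 1[ : set R) (fun x => complex.Im (f x)) &
      (L2norm f < +oo)%E].

Definition cintegral (A : set R) (f : R -> R[i]) : R[i] :=
  (\int[lebesgue_measure]_(x in A) complex.Re (f x)) +i*
  (\int[lebesgue_measure]_(x in A) complex.Im (f x)).

Definition cderive2 (f : R -> R[i]) (x : R) : R[i] :=
  derive1n 2 (fun y => complex.Re (f y)) x +i*
  derive1n 2 (fun y => complex.Im (f y)) x.

(* [f] is the continuous representative on [0, 1] of an element of
   H^2(0,1), with second (weak) derivative [f2]: in one dimension this means
   that f and f' are absolutely continuous and f'' = f2 is in L^2. *)
Definition H2_with_derivative2 (f f2 : R -> R[i]) : Prop :=
  inL2 f2 /\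
  exists f1 : R -> R[i], forall x : R, 0 <= x <= 1 ->
    f x = f 0 + cintegral `[0, x] f1 /\ f1 x = f1 0 + cintegral `[0, x] f2.

End Norms.

Section ModerateNegligible.
Context {R : realType}.

Definition Linfty_moderate (A : set R) (f : R -> R -> R) : Prop :=
  exists N : nat, exists2 C : R, 0 < C &
    forall eps : R, 0 < eps <= 1 ->
      (Linfty_norm A (f eps) <= (C * eps ^- N)%:E)%E.

Definition H2_moderate (f : R -> R -> R[i]) : Prop :=
  exists N : nat, exists2 C : R, 0 < C &
    forall eps : R, 0 < eps <= 1 ->
      (L2norm (f eps) <= (C * eps ^- N)%:E)%E /\
      (L2norm (cderive2 (f eps)) <= (C * eps ^- N)%:E)%E.

Definition Linfty_negligible (A : set R) (f : R -> R -> R) : Prop :=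
  forall N : nat, exists2 C : R, 0 < C &
    forall eps : R, 0 < eps <= 1 ->
      (Linfty_norm A (f eps) <= (C * eps ^+ N)%:E)%E.

Definition L2_negligible (f : R -> R -> R[i]) : Prop :=
  forall N : nat, exists2 C : R, 0 < C &
    forall eps : R, 0 < eps <= 1 ->
      (L2norm (f eps) <= (C * eps ^+ N)%:E)%E.

Definition H2_negligible (f : R -> R -> R[i]) : Prop :=
  L2_negligible f /\ L2_negligible (fun eps => cderive2 (f eps)).

(* Nets depending on time: f eps t x. *)
Definition uniformly_L2_negligible (T : R) (f : R -> R -> R -> R[i]) : Prop :=
  forall N : nat, exists2 C : R, 0 < C &
    forall eps t : R, 0 < eps <= 1 -> 0 <= t <= T ->
      (L2norm (f eps t) <= (C * eps ^+ N)%:E)%E.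

End ModerateNegligible.

Section Problem.
Context {R : realType}.

Definition L2_continuous (T : R) (u : R -> R -> R[i]) : Prop :=
  forall t : R, 0 <= t <= T ->
    inL2 (u t) /\
    L2norm (fun x => u s x - u t x) @[s --> within `[0, T] (nbhs t)] --> 0%E.

(* [ut t] is the derivative at [t] of [u] as an L^2(0,1)-valued map on [0,T]
   (one-sided at the end points). *)
Definition L2_time_derivative (T : R) (u ut : R -> R -> R[i]) : Prop :=
  forall t : R, 0 <= t <= T ->
    inL2 (ut t) /\
    L2norm (fun x => ((s - t)^-1)%:C * (u s x - u t x) - ut t x)
      @[s --> within `[0, T] (t^')] --> 0%E.

(* A solution in C([0,T]; L^2(0,1)): at each time the equation is an equality
   in L^2(0,1), and the boundary values are those of the continuous
   representative of u(t,.). *)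
Definition solves (T : R) (a : R -> R) (q : R -> R) (u0 : R -> R[i])
    (u : R -> R -> R[i]) : Prop :=
  L2_continuous T u /\
  exists ut uxx : R -> R -> R[i],
  [/\ L2_time_derivative T u ut,
      (forall t : R, 0 <= t <= T -> H2_with_derivative2 (u t) (uxx t)),
      (forall t : R, 0 <= t <= T ->
         {ae lebesgue_measure, forall x : R, 0 < x < 1 ->
            'i%C * ut t x + (a t)%:C * (- uxx t x + (q x)%:C * u t x) = 0}),
      (forall x : R, 0 < x < 1 -> u 0 x = u0 x) &
      (forall t : R, 0 <= t <= T -> u t 0 = 0 /\ u t 1 = 0)].

Definition unique_very_weak_solution (T : R) (q : schwartz_distribution (`]0, 1[ : set R))
    (a : schwartz_distribution (`[0, T] : set R))
    (u0 : complex_schwartz_distribution (`]0, 1[ : set R)) : Prop :=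
  forall (qe qe' ae ae' : R -> R -> R) (u0e u0e' : R -> R -> R[i])
         (u u' : R -> R -> R -> R[i]),
  regularisation q qe -> regularisation q qe' ->
  Linfty_moderate `]0, 1[ qe -> Linfty_moderate `]0, 1[ qe' ->
  Linfty_negligible `]0, 1[ (fun eps x => qe eps x - qe' eps x) ->
  regularisation a ae -> regularisation a ae' ->
  Linfty_moderate `[0, T] ae -> Linfty_moderate `[0, T] ae' ->
  Linfty_negligible `[0, T] (fun eps t => ae eps t - ae' eps t) ->
  cregularisation u0 u0e -> cregularisation u0 u0e' ->
  H2_moderate u0e -> H2_moderate u0e' ->
  H2_negligible (fun eps x => u0e eps x - u0e' eps x) ->
  (forall eps : R, 0 < eps <= 1 ->
     solves T (ae eps) (qe eps) (u0e eps) (u eps)) ->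
  (forall eps : R, 0 < eps <= 1 ->
     solves T (ae' eps) (qe' eps) (u0e' eps) (u' eps)) ->
  uniformly_L2_negligible T (fun eps t x => u eps t x - u' eps t x).

End Problem.

(* Main.v *)
Require Import Defs.
From HB Require Import structures.
From mathcomp Require Import all_boot all_order all_algebra.
From mathcomp Require Import complex.
From mathcomp Require Import all_classical all_reals all_analysis.
From mathcomp Require Import measurable_realfun ess_sup_inf ring lra.
Import Order.TTheory GRing.Theory Num.Theory.
Import numFieldNormedType.Exports.
Local Open Scope classical_set_scope.
Local Open Scope ring_scope.

(** Write [L] for the operator [- d^2/dx^2 + q] with Dirichlet conditions.  A
    solution of [i u_t + a L u = 0] is formally [exp (i A(t) L) u_0], where [A]
    is the primitive of [a] vanishing at [0]; hence the L^2 norms of [u(t)] and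
    of [L u(t)] are both conserved, whatever the sign of [a].  If [u'] is a
    second solution, with coefficients [a'] and [q'], the difference
    [U = u - u'] satisfies
    [U_t = i a L U + i (a - a') L' u' + i a (q - q') u'].  As [L] is symmetric,
    the first term does not contribute to the derivative of the energy
    [||U||^2], and the other two contribute at most
    [2 ||U|| (|a - a'| ||L' u'(0)|| + |a| |q - q'| ||u'(0)||)], which is a
    negligible quantity times a moderate one.  Gronwall's inequality concludes:
    this is [evolution_stability], stated for symmetric operators in a space
    with a semi-inner product, and [solutions_stability].

    The delicate point is the second conservation law, because [L u] is not
    known to be differentiable, or even bounded, in time.  For large [mu] the
    function [p = L (L + mu)^-1 u = u - mu (L + mu)^-1 u] is differentiable and
    solves the same equation as [u]; so its norm is constant, and at time [0] it
    is controlled by [L u(0)] ([evolution_resolvent]).  Pairing with a fixed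
    element of the domain and letting [mu] tend to infinity recovers the bound
    needed on [L u(t)] ([evolution_image_pairing]).

    This uses that [L + mu] is onto for large [mu] ([dirichlet_onto]).  With
    [r = q + mu >= 0], solutions of [- f'' + r f = h] with prescribed value and
    slope at [0] are limits of a monotone iteration for the Volterra equation
    ([volterra_solution]); the solution of the homogeneous equation with
    [f(0) = 0] and [f'(0) = 1] stays above [x], so it does not vanish at [1] and
    the condition [f(1) = 0] can be met by shooting.  Symmetry and
    semiboundedness of [L] come from integration by parts for absolutely
    continuous functions ([integral_mul_prim]), that is, from Fubini's theorem on
    a triangle.

    The remaining work is to read the definitions in these terms: essential
    bounds on the coefficients are pointwise bounds because the coefficients are
    continuous ([Linfty_norm_bound]), complex functions become pairs of real
    ones, and Lebesgue's differentiation theorem identifies the weak second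
    derivative of a solution at time [0] with the classical one of the initial
    datum ([derive2_primitive]), so that [L' u'(0)] is moderate. *)

Set Implicit Arguments.
Unset Strict Implicit.
Unset Printing Implicit Defensive.

(** * Scalar differential inequalities *)

Section ScalarInequalities.
Context {R : realType}.
Implicit Types (E dE : R -> R) (T t : R).

Definition continuous_up_to_ends T E := forall t, 0 <= t <= T ->
  E s @[s --> within `[0, T] (nbhs t)] --> E t.

Lemma le_start_of_derive_le0 T E dE :
  continuous_up_to_ends T E ->
  (forall t, 0 < t < T -> is_derive t 1 E (dE t)) ->
  (forall t, 0 < t < T -> dE t <= 0) ->
  forall t, 0 <= t <= T -> E t <= E 0.
Proof.
move=> cE derE dE0 t /andP[t0 tT].
have T0 : 0 <= T := le_trans t0 tT.
have inT s : s \in `]0, T[ -> 0 < s < T by rewrite in_itv.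
apply: (@ler0_derive1_le_cc _ E 0 T) => //.
- by move=> s /inT sT; have [] := derE s sT.
- move=> s /inT sT; have dEs := derE s sT.
  by rewrite derive1E derive_val dE0.
- by apply/subspace_continuousP => s /=; rewrite in_itv/=; exact: cE.
- by rewrite in_itv/= t0 tT.
- by rewrite in_itv/= lexx T0.
Qed.

Lemma constant_of_derive_eq0 T E dE :
  continuous_up_to_ends T E ->
  (forall t, 0 < t < T -> is_derive t 1 E (dE t)) ->
  (forall t, 0 < t < T -> dE t = 0) ->
  forall t, 0 <= t <= T -> E t = E 0.
Proof.
move=> cE derE dE0 t tT; apply/eqP; rewrite eq_le; apply/andP; split.
  by apply: le_start_of_derive_le0 cE derE _ _ tT => s /dE0 ->.
rewrite -lerN2.
apply: (@le_start_of_derive_le0 T (- E) (fun s => - dE s)) tT.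
- by move=> s sT; apply: cvgN; exact: cE.
- by move=> s sT; have dEs := derE s sT; exact: is_deriveN.
- by move=> s /dE0 ->; rewrite oppr0.
Qed.

(** The factor [exp (- t)] turns the differential inequality into
    monotonicity. *)
Lemma gronwall_unit_rate T E dE k :
  continuous_up_to_ends T E ->
  (forall t, 0 < t < T -> is_derive t 1 E (dE t)) ->
  (forall t, 0 < t < T -> dE t <= E t + k) ->
  forall t, 0 <= t <= T -> E t + k <= expR t * (E 0 + k).
Proof.
move=> cE derE dE0 t tT.
have := @le_start_of_derive_le0 T (fun s => expR (- s) * (E s + k))
  (fun s => expR (- s) * (dE s - E s - k)).
move=> /(_ _ _ _ t tT); rewrite oppr0 expR0 mul1r => h.
rewrite -[leLHS](mulVKf (lt0r_neq0 (expR_gt0 t))) -expRN ler_pM2l ?expR_gt0//.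
apply: h.
- move=> s sT; apply: cvgM.
    apply: cvg_within_filter.
    by apply: continuous_comp; [exact: continuousN|exact: continuous_expR].
  by apply: cvgD; [exact: cE|exact: cvg_cst].
- move=> s sT; have dEs := derE s sT.
  apply: is_derive_eq.
  by rewrite /GRing.scale/=; ring.
- move=> s sT; rewrite pmulr_rle0 ?expR_gt0//.
  by have := dE0 s sT; lra.
Qed.

End ScalarInequalities.

(** * Evolution by a symmetric operator *)

Lemma is_derive_of_ratio (R : realType) (E : R -> R) (d t : R) :
  (s - t)^-1 * (E s - E t) @[s --> t^'] --> d -> is_derive t 1 E d.
Proof.
move=> Ed.
have cv : h^-1 *: ((E \o shift t) (h *: (1 : R)) - E t) @[h --> (0 : R)^'] --> d.
  have sh : shift t h @[h --> (0 : R)^'] --> t^'.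
    move=> A tA; rewrite /= /dnbhs /within /= in tA *.
    move/nbhs0P : tA; apply: filterS => h hA h0; rewrite /= addrC.
    by apply: hA; rewrite -subr_eq0 addrAC subrr add0r.
  have := cvg_comp _ _ sh Ed; apply: cvg_trans; apply: near_eq_cvg.
  by near=> h; rewrite /= /GRing.scale/= mulr1 addrK.
by apply: DeriveDef; [apply/cvg_ex; exists d|apply/cvg_lim].
Unshelve. all: by end_near. Qed.

Lemma subrACA (W : zmodType) (a b c d : W) : a - b - (c - d) = a - c - (b - d).
Proof. by rewrite !opprB addrACA (addrC (- b)) addrACA. Qed.

Section SemiInnerProduct.
Context {R : realType} {V : lmodType R}.
Variable ip : V -> V -> R.
Hypothesis ipC : forall f g, ip f g = ip g f.
Hypothesis ip_lin : forall c f g h, ip (c *: f + g) h = c * ip f h + ip g h.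
Hypothesis ip_ge0 : forall f, 0 <= ip f f.
Implicit Types f g h : V.

Lemma ipDl f g h : ip (f + g) h = ip f h + ip g h.
Proof. by rewrite -[f]scale1r ip_lin mul1r scale1r. Qed.

Lemma ip0l h : ip 0 h = 0.
Proof. by apply: (addrI (ip 0 h)); rewrite -ipDl !addr0. Qed.

Lemma ipZl c f h : ip (c *: f) h = c * ip f h.
Proof. by rewrite -[c *: f]addr0 ip_lin ip0l addr0. Qed.

Lemma ipNl f h : ip (- f) h = - ip f h.
Proof. by rewrite -scaleN1r ipZl mulN1r. Qed.

Lemma ipDr f g h : ip h (f + g) = ip h f + ip h g.
Proof. by rewrite ipC ipDl !(ipC h). Qed.

Lemma ipZr c f h : ip h (c *: f) = c * ip h f.
Proof. by rewrite ipC ipZl (ipC h). Qed.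

Lemma ipNr f h : ip h (- f) = - ip h f.
Proof. by rewrite ipC ipNl (ipC h). Qed.

Let ipE := (ipDl, ipZl, ipNl, ipDr, ipZr, ipNr).

Definition nrm f := Num.sqrt (ip f f).

Lemma nrm_ge0 f : 0 <= nrm f.
Proof. exact: sqrtr_ge0. Qed.

Lemma sqr_nrm f : nrm f ^+ 2 = ip f f.
Proof. by rewrite sqr_sqrtr. Qed.

Lemma cauchy_schwarz f g : `|ip f g| <= nrm f * nrm g.
Proof.
have quad c : 0 <= ip f f + 2 * c * ip f g + c ^+ 2 * ip g g.
  apply: le_trans (ip_ge0 (f + c *: g)) _.
  by rewrite !ipE (ipC g f) le_eqVlt; apply/orP; left; apply/eqP; ring.
have sq : ip f g ^+ 2 <= ip f f * ip g g.
  have := ip_ge0 g; rewrite le_eqVlt => /predU1P[g0|g0].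
    rewrite -g0 mulr0; have [->|fg0] := eqVneq (ip f g) 0.
      by rewrite expr0n.
    (* for a null [g] the quadratic is affine in [c] *)
    have := quad (- (ip f f + 1) / (2 * ip f g)).
    rewrite -g0 (_ : _ + _ = -1) ?ler0N1//.
    by field.
  have := quad (- ip f g / ip g g).
  rewrite (_ : _ + _ = (ip f f * ip g g - ip f g ^+ 2) / ip g g); last first.
    by field; rewrite gt_eqF.
  by rewrite pmulr_lge0 ?invr_gt0// subr_ge0.
rewrite -(@ler_pXn2r _ 2)// ?nnegrE ?mulr_ge0 ?nrm_ge0//.
by rewrite exprMn !sqr_nrm real_normK ?num_real.
Qed.

Lemma le_nrm_sqr f k : 0 <= k -> ip f f <= k ^+ 2 -> nrm f <= k.
Proof.
by move=> k0 fk; rewrite -(@ler_pXn2r _ 2)// ?nnegrE ?nrm_ge0// sqr_nrm.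
Qed.

Lemma ler_nrmD f g : nrm (f + g) <= nrm f + nrm g.
Proof.
apply: le_nrm_sqr; first by rewrite addr_ge0 ?nrm_ge0.
have := le_trans (ler_norm _) (cauchy_schwarz f g).
by rewrite !ipE (ipC g f) sqrrD !sqr_nrm => fg; lra.
Qed.

Lemma nrmZ c f : nrm (c *: f) = `|c| * nrm f.
Proof.
by rewrite /nrm ipZl ipZr mulrA -expr2 sqrtrM ?sqr_ge0// sqrtr_sqr.
Qed.

Lemma nrmN f : nrm (- f) = nrm f.
Proof. by rewrite /nrm !ipE opprK. Qed.

(** Solutions are continuous and differentiable in time only as maps into L^2,
    so limits of curves are taken in the seminorm. *)
Definition curve_continuous (T : R) (x : R -> V) := forall t : R, 0 <= t <= T ->
  nrm (x s - x t) @[s --> within `[0, T] (nbhs t)] --> 0.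

Definition curve_derivative (x : R -> V) (x' : V) (t : R) :=
  nrm ((s - t)^-1 *: (x s - x t) - x') @[s --> t^'] --> 0.

Lemma curve_continuous_dominated T (x y : R -> V) C :
  (forall s t, 0 <= s <= T -> 0 <= t <= T ->
    nrm (y s - y t) <= C * nrm (x s - x t)) ->
  curve_continuous T x -> curve_continuous T y.
Proof.
move=> yx cx t tT.
apply: (@squeeze_cvgr _ _ _ _ (fun=> 0) (fun s => C * nrm (x s - x t))).
- near=> s; rewrite nrm_ge0 yx//.
  have : s \in `[0, T] by near: s; exact: withinT.
  by rewrite in_itv.
- exact: cvg_cst.
- by rewrite -[X in _ --> X](mulr0 C); apply: cvgMl_tmp; exact: cx.
Unshelve. all: by end_near. Qed.

Lemma curve_derivative_dominated (x y : R -> V) x' y' (t : R) C :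
  (\forall s \near t^', nrm ((s - t)^-1 *: (y s - y t) - y') <=
     C * nrm ((s - t)^-1 *: (x s - x t) - x')) ->
  curve_derivative x x' t -> curve_derivative y y' t.
Proof.
move=> yx dx.
apply: (@squeeze_cvgr _ _ _ _ (fun=> 0)
  (fun s => C * nrm ((s - t)^-1 *: (x s - x t) - x'))).
- by near=> s; rewrite nrm_ge0 /=; near: s.
- exact: cvg_cst.
- by rewrite -[X in _ --> X](mulr0 C); exact: cvgMl_tmp.
Unshelve. all: by end_near. Qed.

Lemma curve_sub_continuous T x y : curve_continuous T x ->
  curve_continuous T y -> curve_continuous T (fun t => x t - y t).
Proof.
move=> cx cy t tT.
apply: (@squeeze_cvgr _ _ _ _ (fun=> 0)
  (fun s => nrm (x s - x t) + nrm (y s - y t))).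
- near=> s; rewrite nrm_ge0/= (_ : _ - _ = (x s - x t) - (y s - y t)).
    by rewrite -(nrmN (y s - y t)) ler_nrmD.
  by rewrite subrACA.
- exact: cvg_cst.
- by rewrite -[X in _ --> X]addr0; apply: cvgD; [exact: cx|exact: cy].
Unshelve. all: by end_near. Qed.

Lemma curve_sub_derivative x y x' y' (t : R) : curve_derivative x x' t ->
  curve_derivative y y' t -> curve_derivative (fun t => x t - y t) (x' - y') t.
Proof.
move=> dx dy.
apply: (@squeeze_cvgr _ _ _ _ (fun=> 0)
  (fun s => nrm ((s - t)^-1 *: (x s - x t) - x') +
            nrm ((s - t)^-1 *: (y s - y t) - y'))).
- near=> s; rewrite nrm_ge0/= -(nrmN (_ *: (y s - y t) - y')).
  apply: le_trans (ler_nrmD _ _); rewrite le_eqVlt; apply/orP; left; apply/eqP.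
  by rewrite (subrACA (x s)) (scalerBr _ (x s - x t)) subrACA.
- exact: cvg_cst.
- by rewrite -[0]addr0; exact: cvgD.
Unshelve. all: by end_near. Qed.

Lemma continuous_energy T x : curve_continuous T x ->
  continuous_up_to_ends T (fun t => ip (x t) (x t)).
Proof.
move=> cx t tT; apply/cvgrPdist_le => e e0.
have cvb : nrm (x s - x t) * (nrm (x s - x t) + 2 * nrm (x t))
    @[s --> within `[0, T] (nbhs t)] --> 0.
  rewrite -[X in _ --> X](mul0r (0 + 2 * nrm (x t))); apply: cvgM; first exact: cx.
  by apply: cvgD; [exact: cx|exact: cvg_cst].
near=> s; apply: (@le_trans _ _
    (nrm (x s - x t) * (nrm (x s - x t) + 2 * nrm (x t)))); last first.
  apply: le_trans (ler_norm _) _.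
  by near: s; move/cvgr0_norm_le : cvb; apply.
rewrite (_ : _ - _ = - (ip (x s - x t) (x s - x t + 2 *: x t))); last first.
  by rewrite !ipE (ipC (x t) (x s)); ring.
rewrite normrN (le_trans (cauchy_schwarz _ _))// ler_wpM2l ?nrm_ge0//.
by rewrite (le_trans (ler_nrmD _ _))// nrmZ ger0_norm.
Unshelve. all: by end_near. Qed.

(** The incremental ratio of the energy is
    [2 ip x' (x t) + 2 ip d (x t) + (s - t) ip (x' + d) (x' + d)], where [d]
    is the error of the incremental ratio of [x]. *)
Lemma is_derive_energy x x' (t : R) : curve_derivative x x' t ->
  is_derive t 1 (fun s => ip (x s) (x s)) (2 * ip x' (x t)).
Proof.
move=> dx; apply: is_derive_of_ratio.
pose d s := nrm ((s - t)^-1 *: (x s - x t) - x').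
have cvb : 2 * (d s * nrm (x t)) + `|s - t| * (nrm x' + d s) ^+ 2
    @[s --> t^'] --> 0.
  rewrite -[X in _ --> X]addr0; apply: cvgD.
    rewrite -[X in _ --> X](mulr0 2) -[X in 2 * X](mul0r (nrm (x t))).
    by apply: cvgMl_tmp; exact: cvgMr_tmp.
  rewrite -[X in _ --> X](mul0r ((nrm x' + 0) ^+ 2)); apply: cvgM.
    apply/norm_cvg0P; rewrite -[X in _ --> X](subrr t).
    by apply: cvgB; [exact: nbhs_dnbhs|exact: cvg_cst].
  by rewrite expr2; under eq_fun do rewrite expr2; apply: cvgM;
    (apply: cvgD; [exact: cvg_cst|exact: dx]).
apply/cvgrPdist_le => e e0; near=> s.
have st : s - t != 0 by rewrite subr_eq0; near: s; exact: nbhs_dnbhs_neq.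
apply: (@le_trans _ _ (2 * (d s * nrm (x t)) + `|s - t| * (nrm x' + d s) ^+ 2));
  last first.
  apply: le_trans (ler_norm _) _.
  by near: s; move/cvgr0_norm_le : cvb; apply.
rewrite /d; set D := (s - t)^-1 *: (x s - x t) - x'.
have xs : x s = x t + (s - t) *: (x' + D).
  by rewrite /D [x' + _]addrC subrK scalerA mulfV// scale1r addrC subrK.
rewrite (_ : 2 * _ - _ = - (2 * ip D (x t) + (s - t) * ip (x' + D) (x' + D)));
  last first.
  rewrite xs; move: D {xs} => D.
  by rewrite !ipE (ipC (x t) x') (ipC (x t) D) (ipC D x'); field.
rewrite normrN (le_trans (ler_normD _ _))// lerD//.
  by rewrite normrM ger0_norm// ler_wpM2l// cauchy_schwarz.
rewrite normrM ler_wpM2l// ger0_norm// -sqr_nrm.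
by rewrite ler_pXn2r ?nnegrE ?addr_ge0 ?nrm_ge0// ler_nrmD.
Unshelve. all: by end_near. Qed.

Section SymmetricEvolution.
Variable J : {linear V -> V}.
Hypothesis J_isometry : forall f g, ip (J f) (J g) = ip f g.
Hypothesis J_skew : forall f g, ip (J f) g = - ip f (J g).

(** An unbounded operator is given by its graph, which makes its domain
    implicit. *)
Implicit Types G : V -> V -> Prop.

Definition graph_linear G := forall c f f' g g',
  G f f' -> G g g' -> G (c *: f + g) (c *: f' + g').

Definition graph_symmetric G := forall f f' g g',
  G f f' -> G g g' -> ip f' g = ip f g'.

Definition graph_commutes G := forall f f', G f f' -> G (J f) (J f').

Definition graph_bounded_below G (Q : R) := forall f f',
  G f f' -> - Q * ip f f <= ip f' f.

Definition graph_shift_onto G (Q : R) := forall mu, Q < mu ->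
  forall h, exists f f', G f f' /\ f' + mu *: f = h.

Definition evolves G (T : R) (a : R -> R) (x g : R -> V) :=
  [/\ curve_continuous T x,
      forall t, 0 <= t <= T -> G (x t) (g t) &
      forall t, 0 < t < T -> curve_derivative x (a t *: J (g t)) t].

Section OneOperator.
Variable G : V -> V -> Prop.
Hypothesis G_lin : graph_linear G.
Hypothesis G_sym : graph_symmetric G.
Hypothesis G_J : graph_commutes G.

Lemma graphB f f' g g' : G f f' -> G g g' -> G (f - g) (f' - g').
Proof.
move=> Gf Gg; rewrite addrC (addrC f') -(scaleN1r g) -(scaleN1r g').
exact: G_lin.
Qed.

Lemma graphZ c f f' : G f f' -> G (c *: f) (c *: f').
Proof.
move=> Gf; have := graphB Gf Gf; rewrite !subrr => G0.
by have := G_lin c Gf G0; rewrite !addr0.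
Qed.

(** [J] plays the role of the imaginary unit: it commutes with the symmetric
    operator, so their product is skew-symmetric. *)
Lemma graph_rotation_orthogonal f f' : G f f' -> ip (J f') f = 0.
Proof.
move=> Gf; have e : ip (J f') f = - ip (J f') f.
  by rewrite {1}(G_sym (G_J Gf) Gf) J_skew (ipC f).
by lra.
Qed.

Lemma evolution_mass T a x (g : R -> V) : evolves G T a x g ->
  forall t, 0 <= t <= T -> nrm (x t) = nrm (x 0).
Proof.
move=> [cx Gx dx] t tT; congr Num.sqrt.
apply: (@constant_of_derive_eq0 _ T (fun t => ip (x t) (x t))
  (fun t => 2 * ip (a t *: J (g t)) (x t))) tT.
- exact: continuous_energy.
- by move=> s sT; apply: is_derive_energy; exact: dx.
- move=> s /andP[s0 sT]; rewrite ipZl graph_rotation_orthogonal ?mulr0//.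
  by apply: Gx; rewrite !ltW.
Qed.

Variable Q : R.
Hypothesis Q_ge0 : 0 <= Q.
Hypothesis G_below : graph_bounded_below G Q.

Lemma resolvent_bound mu f f' : Q < mu -> G f f' ->
  (mu - Q) * nrm f <= nrm (f' + mu *: f).
Proof.
move=> Qmu Gf; have := nrm_ge0 f; rewrite le_eqVlt => /predU1P[<-|f0].
  by rewrite mulr0 nrm_ge0.
rewrite -(ler_pM2r f0) -mulrA -expr2 sqr_nrm.
apply: le_trans (le_trans (ler_norm _) (cauchy_schwarz _ _)).
by rewrite !ipE; have := G_below Gf; lra.
Qed.

Lemma resolvent_image_bound mu f f' : Q < mu -> G f f' ->
  nrm f' <= (1 + mu / (mu - Q)) * nrm (f' + mu *: f).
Proof.
move=> Qmu Gf.
have mu0 : 0 < mu := le_lt_trans Q_ge0 Qmu.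
have : nrm f' <= nrm (f' + mu *: f) + mu * nrm f.
  rewrite -{2}(gtr0_norm mu0) -nrmZ -(nrmN (mu *: f)).
  by apply: le_trans (ler_nrmD _ _); rewrite addrK.
move/le_trans; apply; rewrite mulrDl mul1r lerD2l -mulrA ler_pM2l//.
by rewrite ler_pdivlMl ?subr_gt0// resolvent_bound.
Qed.

Hypothesis G_onto : graph_shift_onto G Q.

(** For [b = (G + mu)^-1 x], the curve [p = G b = x - mu b] solves the same
    evolution equation, so its norm is conserved, and at time [0] it is the
    resolvent of [g 0].  This is how [g t] is controlled although [g] itself is
    not known to be differentiable. *)
Lemma evolution_resolvent T a x (g : R -> V) mu : Q < mu -> evolves G T a x g ->
  exists p : R -> V, forall t : R, 0 <= t <= T ->
    G (p t) (g t - mu *: p t) /\ (mu - Q) * nrm (p t) <= nrm (g 0).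
Proof.
move=> Qmu ex; have [cx Gx dx] := ex.
have /choice[b /choice[p bp]] : forall t, exists f f', G f f' /\ f' + mu *: f = x t.
  by move=> t; exact: G_onto.
have Gb t : G (b t) (p t) by have [] := bp t.
have pb t : p t + mu *: b t = x t by have [] := bp t.
have Gp t : 0 <= t <= T -> G (p t) (g t - mu *: p t).
  move=> tT; rewrite (_ : p t = - mu *: b t + x t); last first.
    by rewrite -pb addrC scaleNr addrK.
  rewrite (_ : g t - _ = - mu *: p t + g t); last first.
    by rewrite -pb addrCA scaleNr addNr addr0 addrC scaleNr.
  by apply: G_lin; [exact: Gb|exact: Gx].
have ep : evolves G T a p (fun t => g t - mu *: p t).
  split=> //.
    apply: curve_continuous_dominated cx => s t sT tT.
    rewrite (_ : x s - x t = (p s - p t) + mu *: (b s - b t)); last first.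
      by rewrite -!pb opprD addrACA -scalerBr.
    by apply: resolvent_image_bound => //; exact: graphB.
  move=> t tT0; have tT : 0 <= t <= T by have /andP[? ?] := tT0; rewrite !ltW.
  apply: curve_derivative_dominated (dx t tT0).
  apply: nearW => s.
  set c := (s - t)^-1.
  rewrite (_ : c *: (x s - x t) - _ =
    (c *: (p s - p t) - a t *: J (g t - mu *: p t)) +
    mu *: (c *: (b s - b t) - a t *: J (p t))); last first.
    have -> : a t *: J (g t - mu *: p t) =
        a t *: J (g t) - mu *: (a t *: J (p t)).
      by rewrite (linearB J) (linearZ_LR J) scalerBr !scalerA mulrC.
    have e (P B Y Z : V) : P - (Y - Z) + (B - Z) = P + B - Y.
      by rewrite opprB -addrA [X in _ + X]addrC subrKA addrA.
    rewrite (scalerBr mu) e -!pb opprD addrACA -scalerBr scalerDr.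
    by rewrite !scalerA (mulrC c).
  apply: resolvent_image_bound => //.
  by apply: graphB; apply: graphZ; [exact: graphB|exact/G_J/Gp].
exists p => t tT; split; first exact: Gp.
have T0 : 0 <= T by have /andP[] := tT; exact: le_trans.
rewrite (evolution_mass ep)//.
have := resolvent_bound Qmu (Gp 0 _); rewrite lexx T0 => /(_ isT).
by rewrite subrK.
Qed.

(** In the notation of [evolution_resolvent], with [f' = G f], the pairing of
    [J (g t)] with [f] is that of [J (p t)] with [f' + mu *: f].  The resulting
    bound is affine in [mu], and comparing the leading coefficients as [mu] tends
    to infinity removes the contribution of [f']. *)
Lemma evolution_image_pairing T a x (g : R -> V) : evolves G T a x g ->
  forall t f f', 0 <= t <= T -> G f f' ->
  `|ip (J (g t)) f| <= nrm (g 0) * nrm f.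
Proof.
move=> ex t f f' tT Gf; set P := `|_|.
have bound mu : Q < mu -> P * (mu - Q) <= nrm (g 0) * (nrm f' + mu * nrm f).
  move=> Qmu; have [p /(_ t tT)[Gp pg]] := evolution_resolvent Qmu ex.
  have mu0 : 0 < mu := le_lt_trans Q_ge0 Qmu.
  have -> : P = `|ip (J (p t)) (f' + mu *: f)|.
    congr (`|_|); rewrite !ipE -(G_sym (G_J Gp) Gf) -ipZl -ipDl.
    by rewrite -linearZ -linearD subrK.
  have nJp : nrm (J (p t)) = nrm (p t) by rewrite /nrm J_isometry.
  have muQ : 0 < mu - Q by rewrite subr_gt0.
  have h : nrm (f' + mu *: f) <= nrm f' + mu * nrm f.
    by apply: le_trans (ler_nrmD _ _) _; rewrite nrmZ gtr0_norm.
  have := cauchy_schwarz (J (p t)) (f' + mu *: f); rewrite nJp => cs.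
  rewrite mulrC; apply: (@le_trans _ _ ((mu - Q) * nrm (p t) * nrm (f' + mu *: f))).
    by rewrite -mulrA ler_pM2l.
  by apply: ler_pM; rewrite ?mulr_ge0 ?nrm_ge0// ltW.
have P0 : 0 <= P by exact: normr_ge0.
have := nrm_ge0 (g 0); have := nrm_ge0 f; have := nrm_ge0 f'; clearbody P.
move: (nrm (g 0)) (nrm f) (nrm f') bound => M n w bound w0 n0 M0.
rewrite leNgt; apply/negP => PMn.
have d0 : 0 < P - M * n by rewrite subr_gt0.
(* chosen so that [mu * (P - M * n)] exceeds [M * w + Q * P] *)
pose mu := Q + 1 + (M * w + Q * P) / (P - M * n).
have Qmu : Q < mu.
  rewrite /mu -addrA ltrDl ltr_pwDl// divr_ge0 ?(ltW d0)//.
  by rewrite addr_ge0 ?mulr_ge0.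
have := bound mu Qmu.
have : mu * (P - M * n) = (Q + 1) * (P - M * n) + (M * w + Q * P).
  by rewrite /mu mulrDl divfK// gt_eqF.
have : 0 < (Q + 1) * (P - M * n) by rewrite mulr_gt0// ltr_wpDl.
by lra.
Qed.

End OneOperator.

(** The energy of the difference [x - y] grows only through the difference of
    the speeds, tested against the image of [y] under its operator, and through
    the difference [d] of the two operators. *)
Lemma evolution_stability G G' Q T a b (x y g h d : R -> V) ea A eta :
  graph_linear G -> graph_symmetric G -> graph_commutes G ->
  graph_linear G' -> graph_symmetric G' -> graph_commutes G' ->
  0 <= Q -> graph_bounded_below G' Q -> graph_shift_onto G' Q ->
  (forall f f', G f f' -> exists f'', G' f f'') ->
  evolves G T a x g -> evolves G' T b y h ->
  (forall t, 0 <= t <= T -> G (y t) (h t + d t)) ->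
  (forall t, 0 <= t <= T -> nrm (d t) <= eta * nrm (y t)) ->
  (forall t, 0 < t < T -> `|a t - b t| <= ea) ->
  (forall t, 0 < t < T -> `|a t| <= A) ->
  forall t, 0 <= t <= T ->
    ip (x t - y t) (x t - y t) <=
    expR t * (ip (x 0 - y 0) (x 0 - y 0) +
              (ea * nrm (h 0) + A * eta * nrm (y 0)) ^+ 2).
Proof.
move=> Gl Gs GJ Gl' Gs' GJ' Q0 Gb' Go' GG' ex ey Gy hd hab ha t tT.
set k := ea * _ + _.
have [cx Gx dx] := ex; have [cy Gy' dy] := ey.
apply: (@le_trans _ _ (ip (x t - y t) (x t - y t) + k ^+ 2)).
  by rewrite lerDl sqr_ge0.
apply: (@gronwall_unit_rate _ T (fun t => ip (x t - y t) (x t - y t))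
  (fun t => 2 * ip (a t *: J (g t) - b t *: J (h t)) (x t - y t))) tT.
- by apply: continuous_energy; exact: curve_sub_continuous.
- move=> s sT; apply: is_derive_energy (fun t => x t - y t) _ _ _.
  by apply: curve_sub_derivative; [exact: dx|exact: dy].
move=> s sT; have sT' : 0 <= s <= T by have /andP[? ?] := sT; rewrite !ltW.
set U := x s - y s.
have GU : G U (g s - (h s + d s)) by apply: graphB => //; [exact: Gx|exact: Gy].
have [W GU'] := GG' _ _ GU.
have -> : a s *: J (g s) - b s *: J (h s) =
    a s *: J (g s - (h s + d s)) + ((a s - b s) *: J (h s) + a s *: J (d s)).
  rewrite (linearB J) (linearD J) scalerBl scalerBr scalerDr.
  by rewrite (addrAC (a s *: J (h s))) subrKA.
rewrite [X in 2 * X](_ : _ = (a s - b s) * ip (J (h s)) U +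
    a s * ip (J (d s)) U); last first.
  move: U GU {GU'} => U GU.
  by rewrite !ipDl !ipZl (graph_rotation_orthogonal Gs GJ GU) mulr0 add0r.
have h1 : `|(a s - b s) * ip (J (h s)) U| <= ea * (nrm (h 0) * nrm U).
  rewrite normrM ler_pM//; first exact: hab.
  exact: (@evolution_image_pairing G' Gl' Gs' GJ' Q Q0 Gb' Go' T b y h ey s U W).
have h2 : `|a s * ip (J (d s)) U| <= A * (eta * nrm (y 0) * nrm U).
  rewrite normrM ler_pM//; first exact: ha.
  apply: le_trans (cauchy_schwarz _ _) _; rewrite ler_wpM2r ?nrm_ge0//.
  have -> : nrm (J (d s)) = nrm (d s) by rewrite /nrm J_isometry.
  by rewrite -(evolution_mass Gs' GJ' ey sT'); exact: hd.
have := le_trans (ler_norm _) h1; have := le_trans (ler_norm _) h2.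
rewrite /= -/U -sqr_nrm; move: (nrm U) => n h2' h1'.
have : 0 <= (n - k) ^+ 2 by exact: sqr_ge0.
have : (ea * nrm (h 0) + A * eta * nrm (y 0)) * n = k * n by [].
by lra.
Qed.

End SymmetricEvolution.

End SemiInnerProduct.

(** * Square integrable functions and primitives on the unit interval *)

Section UnitInterval.
Context {R : realType}.
Notation mu := (@lebesgue_measure R).
Notation I01 := (`[0, 1]%classic : set R).
Implicit Types (f g h p : R -> R) (x : R).

Definition integrable01 f := mu.-integrable I01 (EFin \o f).

Definition bounded01 f := exists C, forall x, 0 <= x <= 1 -> `|f x| <= C.

Lemma measurable01 : measurable (I01 : set (measurableTypeR R)). Proof. exact: measurable_itv. Qed.
Hint Resolve measurable01 : core.

Lemma inI01 x : (x \in I01) = (0 <= x <= 1).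
Proof. by rewrite mem_setE in_itv. Qed.

Lemma I01E x : I01 x = (0 <= x <= 1) :> Prop.
Proof. by rewrite /= in_itv. Qed.

Lemma measure_I01 : mu I01 = 1%:E.
Proof. by rewrite lebesgue_measure_itv/= lte01 sube0. Qed.

Lemma integrable01_measurable f : integrable01 f -> measurable_fun I01 f.
Proof. by move=> /measurable_int/measurable_EFinP. Qed.

Lemma dominated_integrable01 f g : measurable_fun I01 f -> integrable01 g ->
  (forall x, 0 <= x <= 1 -> `|f x| <= g x) -> integrable01 f.
Proof.
move=> mf ig fg; apply: le_integrable ig => //; first exact/measurable_EFinP.
move=> x; rewrite I01E => x01 /=; rewrite lee_fin.
by rewrite (le_trans (fg x x01))// ler_norm.
Qed.

Lemma integrable01_cst (c : R) : integrable01 (cst c).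
Proof.
apply/integrableP; split; first by apply/measurable_EFinP.
by rewrite /= integral_cst//= measure_I01 mule1 ltry.
Qed.

Lemma bounded_integrable01 f : measurable_fun I01 f -> bounded01 f ->
  integrable01 f.
Proof.
by move=> mf [C fC]; apply: dominated_integrable01 mf (integrable01_cst C) fC.
Qed.

Lemma integrable01D f g : integrable01 f -> integrable01 g ->
  integrable01 (fun x => f x + g x).
Proof. by move=> fi gi; exact: (integrableD measurable01 fi gi). Qed.

Lemma integrable01Z (c : R) f : integrable01 f -> integrable01 (fun x => c * f x).
Proof. by move=> fi; exact: (integrableZl measurable01 c fi). Qed.

Lemma integrable01_norm f : integrable01 f -> integrable01 (fun x => `|f x|).
Proof. by move=> fi; exact: (integrable_abse fi). Qed.

Lemma bounded_mul_integrable01 p f : measurable_fun I01 p -> bounded01 p ->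
  integrable01 f -> integrable01 (fun x => p x * f x).
Proof.
move=> mp [C pC] fi.
apply: (@dominated_integrable01 _ (fun x => C * `|f x|)).
- by apply: measurable_funM => //; exact: integrable01_measurable.
- by apply: integrable01Z; exact: integrable01_norm.
- by move=> x x01; rewrite normrM ler_wpM2r// pC.
Qed.

(** ** Square integrable functions *)

Definition sqint f := measurable_fun I01 f /\ integrable01 (fun x => f x ^+ 2).

Lemma sqint_mul_integrable f g : sqint f -> sqint g ->
  integrable01 (fun x => f x * g x).
Proof.
move=> [mf f2] [mg g2].
apply: (@dominated_integrable01 _ (fun x => f x ^+ 2 + g x ^+ 2)).
- exact: measurable_funM.
- exact: integrable01D.
- move=> x _; rewrite normrM -(real_normK (num_real (f x))).
  rewrite -(real_normK (num_real (g x))).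
  have := normr_ge0 (f x); have := normr_ge0 (g x).
  by move: `|f x| `|g x| => u v; nra.
Qed.

Lemma bounded_sqint f : measurable_fun I01 f -> bounded01 f -> sqint f.
Proof.
move=> mf [C fC]; split=> //; apply: bounded_integrable01.
  exact: measurable_funX.
exists (C ^+ 2) => x x01; rewrite normrX ler_pXn2r ?nnegrE//; first exact: fC.
exact: le_trans (fC x x01).
Qed.

Lemma sqint_integrable f : sqint f -> integrable01 f.
Proof.
move=> sf; have /(sqint_mul_integrable sf) : sqint (cst 1).
  by apply: bounded_sqint => //; exists 1 => x _; rewrite normr1.
by under eq_fun do rewrite mulr1.
Qed.

Lemma sqint_lin (c : R) f g : sqint f -> sqint g -> sqint (fun x => c * f x + g x).
Proof.
move=> sf sg; have [mf f2] := sf; have [mg g2] := sg; split.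
  by apply: measurable_funD => //; exact: measurable_funM.
under eq_fun => x.
  rewrite (_ : _ ^+ 2 = c ^+ 2 * f x ^+ 2 + (2 * c * (f x * g x) + g x ^+ 2)).
    over.
  by ring.
apply: integrable01D; first exact: integrable01Z.
by apply: integrable01D => //; apply/integrable01Z/sqint_mul_integrable.
Qed.

Lemma bounded_mul_sqint p f : measurable_fun I01 p -> bounded01 p ->
  sqint f -> sqint (fun x => p x * f x).
Proof.
move=> mp [C pC] [mf f2]; split; first exact: measurable_funM.
under eq_fun do rewrite exprMn.
apply: bounded_mul_integrable01 => //; first exact: measurable_funX.
exists (C ^+ 2) => x x01; rewrite normrX ler_pXn2r ?nnegrE//; first exact: pC.
exact: le_trans (pC x x01).
Qed.

(** ** Primitives *)

Definition prim f x := \int[mu]_(z in `[0, x]) f z.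

Lemma integrable01_sub f x : integrable01 f -> 0 <= x <= 1 ->
  mu.-integrable `[0, x] (EFin \o f).
Proof.
move=> fi /andP[_ x1]; apply: integrableS fi => //.
exact: subset_itvl.
Qed.

Lemma prim0 f : prim f 0 = 0.
Proof. by rewrite /prim set_itv1 Rintegral_set1. Qed.

Lemma primD f g x : integrable01 f -> integrable01 g -> 0 <= x <= 1 ->
  prim (fun z => f z + g z) x = prim f x + prim g x.
Proof.
by move=> fi gi x01; rewrite /prim RintegralD//; exact: integrable01_sub.
Qed.

Lemma primZ (c : R) f x : integrable01 f -> 0 <= x <= 1 ->
  prim (fun z => c * f z) x = c * prim f x.
Proof.
by move=> fi x01; rewrite /prim RintegralZl//; exact: integrable01_sub.
Qed.

Lemma eq_prim f g x : 0 <= x <= 1 ->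
  (forall z, 0 <= z <= 1 -> f z = g z) -> prim f x = prim g x.
Proof.
move=> /andP[_ x1] fg; apply: eq_Rintegral => z.
rewrite mem_setE in_itv/= => /andP[z0 zx]; apply: fg.
by rewrite z0 (le_trans zx).
Qed.

Lemma le_prim f g x : integrable01 f -> integrable01 g -> 0 <= x <= 1 ->
  (forall z, 0 <= z <= 1 -> f z <= g z) -> prim f x <= prim g x.
Proof.
move=> fi gi x01 fg; apply: le_Rintegral => //.
- exact: integrable01_sub.
- exact: integrable01_sub.
- move=> z; rewrite /= in_itv/= => /andP[z0 zx]; apply: fg.
  by rewrite z0 (le_trans zx)//; case/andP: x01.
Qed.

Lemma prim_ge0 f x : 0 <= x <= 1 ->
  (forall z, 0 <= z <= 1 -> 0 <= f z) -> 0 <= prim f x.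
Proof.
move=> /andP[_ x1] f0; apply: Rintegral_ge0 => z.
rewrite /= in_itv/= => /andP[z0 zx]; apply: f0.
by rewrite z0 (le_trans zx).
Qed.

Lemma prim_cst (c : R) x : 0 <= x <= 1 -> prim (cst c) x = c * x.
Proof.
move=> /andP[x0 _]; rewrite /prim Rintegral_cst//; congr (_ * _).
suff lx : mu (`[0, x]%classic : set R) = x%:E by exact: (congr1 fine lx).
rewrite lebesgue_measure_itv/=; case: ifP => [_|]; first by rewrite sube0.
rewrite lte_fin => /negbT; rewrite -leNgt => xle0.
by congr EFin; apply/eqP; rewrite eq_le x0.
Qed.

Lemma le_norm_prim f (c : R) x : integrable01 f -> 0 <= x <= 1 ->
  (forall z, 0 <= z <= 1 -> `|f z| <= c) -> `|prim f x| <= c.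
Proof.
move=> fi x01 fc; have /andP[x0 x1] := x01.
have c0 : 0 <= c by apply: le_trans (fc 0 _); rewrite ?lexx ?ler01.
have cx : c * x <= c by rewrite ler_piMr.
have up : prim f x <= prim (cst c) x.
  apply: le_prim => //; first exact: integrable01_cst.
  by move=> z /fc; rewrite ler_norml => /andP[].
have lo : prim (cst (- c)) x <= prim f x.
  apply: le_prim => //; first exact: integrable01_cst.
  by move=> z /fc; rewrite ler_norml => /andP[].
by move: up lo; rewrite !prim_cst// ler_norml mulNr => up lo; apply/andP; split; lra.
Qed.

Lemma prim_continuous f : integrable01 f -> {within I01, continuous (prim f)}.
Proof. by move=> fi; exact: (parameterized_integral_continuous ler01 fi). Qed.

Lemma prim_measurable f : integrable01 f -> measurable_fun I01 (prim f).
Proof.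
move=> fi; apply: subspace_continuous_measurable_fun => //.
exact: prim_continuous.
Qed.

Lemma prim_bounded f : integrable01 f -> bounded01 (prim f).
Proof.
move=> fi; exists (\int[mu]_(z in I01) `|f z|) => x x01.
have fx := integrable01_sub fi x01.
apply: (le_trans (le_normr_Rintegral _ fx)) => //.
rewrite /Rintegral fine_le//.
- by apply: integrable_fin_num => //; exact: integrable_abse fx.
- by apply: integrable_fin_num => //; exact: integrable_abse fi.
apply: ge0_subset_integral => //.
  apply/measurable_EFinP; apply: measurableT_comp => //.
  exact: integrable01_measurable.
by case/andP: x01 => _ x1; exact: subset_itvl.
Qed.

Lemma prim_integrable f : integrable01 f -> integrable01 (prim f).
Proof.
by move=> fi; apply: bounded_integrable01; [exact: prim_measurable|exact: prim_bounded].
Qed.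

Section BoundedLimit.
Variables (f_ : nat -> R -> R) (f : R -> R) (C : R).
Hypothesis mf : forall n, measurable_fun I01 (f_ n).
Hypothesis fC : forall n x, 0 <= x <= 1 -> `|f_ n x| <= C.
Hypothesis ff : forall x, 0 <= x <= 1 -> f_ n x @[n --> \oo] --> f x.

Lemma bounded_limit_measurable : measurable_fun I01 f.
Proof.
apply: (@measurable_fun_cvg _ _ _ _ f_) => // x.
Qed.

Lemma bounded_limit_bounded x : 0 <= x <= 1 -> `|f x| <= C.
Proof.
move=> x01; apply: (ler_cvg_to (cvg_norm (ff x01)) (cvg_cst C)).
by apply: nearW => n; exact: fC.
Qed.

Lemma bounded_limit_integrable : integrable01 f.
Proof.
apply: bounded_integrable01; first exact: bounded_limit_measurable.
by exists C; exact: bounded_limit_bounded.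
Qed.

Lemma prim_cvg x : 0 <= x <= 1 -> prim (f_ n) x @[n --> \oo] --> prim f x.
Proof.
move=> x01.
have sub z : `[0, x]%classic z -> 0 <= z <= 1.
  rewrite /= in_itv/= => /andP[z0 zx]; rewrite z0 (le_trans zx)//.
  by case/andP: x01.
have mfx n : measurable_fun `[0, x] (f_ n).
  by apply: measurable_funS (mf n) => // z /sub; rewrite I01E.
apply: fine_cvg; rewrite fineK; last first.
  by apply: integrable_fin_num => //; exact: integrable01_sub bounded_limit_integrable x01.
apply: (@dominated_cvg _ _ _ mu `[0, x]%classic _ (fun n => EFin \o f_ n)
  (EFin \o f) (EFin \o cst C)) => //.
- by move=> n; apply/measurable_EFinP; exact: mfx.
- by move=> z /sub z01; apply: cvg_EFin; [exact: nearW|exact: ff].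
- exact: integrable01_sub (integrable01_cst C) x01.
- by move=> n z /sub z01; rewrite lee_fin fC.
Qed.

End BoundedLimit.

End UnitInterval.

(** * Integration by parts for primitives of integrable functions *)

Section IntegrationByParts.
Context {R : realType}.
Notation mu := (@lebesgue_measure R).
Notation I01 := (`[0, 1]%classic : set R).
Implicit Types (f g h p : R -> R) (x : R).
Hint Resolve measurable01 : core.

Lemma integrable01_patch f : integrable01 f ->
  mu.-integrable setT (EFin \o (f \_ I01)).
Proof.
by move=> fi; rewrite -restrict_EFin; exact/(integrable_mkcond _ measurable01).
Qed.

Lemma patch_left f x y : 0 <= x <= 1 ->
  (if y <= x then (f \_ I01) y else 0) = (f \_ `[0, x]) y.
Proof.
move=> /andP[x0 x1]; rewrite !patchE !mem_setE !in_itv/=.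
have [yx|xy] := leP y x; last by rewrite andbF.
by rewrite (le_trans yx x1) !andbT; case: ifP.
Qed.

Lemma patch_right f x y : 0 <= y <= 1 ->
  (if y <= x then (f \_ I01) x else 0) = (f \_ `[y, 1]) x.
Proof.
move=> /andP[y0 y1]; rewrite !patchE !mem_setE !in_itv/=.
have [yx|xy] := leP y x; last by [].
by rewrite (le_trans y0 yx) /=; case: ifP.
Qed.

Lemma integral_scaled_patch (D : set (measurableTypeR R)) f (c : R) :
  measurable D -> mu.-integrable D (EFin \o f) ->
  (\int[mu]_y (c * (f \_ D) y)%:E)%E = (c * \int[mu]_(y in D) f y)%:E.
Proof.
move=> mD fi; rewrite -RintegralZl// /Rintegral fineK; last first.
  by apply: integrable_fin_num => //; exact: (integrableZl mD c fi).
rewrite [RHS]integral_mkcond; apply: eq_integral => y _.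
by rewrite !patchE; case: ifP; rewrite ?mulr0.
Qed.

(** The integral of [f x * g y] over the triangle [y <= x] of the unit square,
    computed in the two orders. *)
Lemma triangle_fubini f g : integrable01 f -> integrable01 g ->
  \int[mu]_(x in I01) (f x * prim g x) =
  \int[mu]_(y in I01) (g y * (prim f 1 - prim f y)).
Proof.
move=> fi gi.
have fT := integrable01_patch fi; have gT := integrable01_patch gi.
have mf : measurable_fun setT (f \_ I01).
  by apply/measurable_EFinP; exact: measurable_int fT.
have mg : measurable_fun setT (g \_ I01).
  by apply/measurable_EFinP; exact: measurable_int gT.
pose F (z : measurableTypeR R * measurableTypeR R) :=
  if z.2 <= z.1 then (f \_ I01) z.1 * (g \_ I01) z.2 else 0.
have mF : measurable_fun setT F.
  apply: measurable_fun_ifT => //.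
    by apply: measurable_fun_ler; [exact: measurable_snd|exact: measurable_fst].
  apply: measurable_funM.
    by apply: measurableT_comp => //; exact: measurable_fst.
  by apply: measurableT_comp => //; exact: measurable_snd.
have iF : (mu \x mu)%E.-integrable setT (EFin \o F).
  apply/integrable12ltyP; first exact/measurable_EFinP.
  pose K := (\int[mu]_y `|((g \_ I01) y)%:E|)%E.
  have Klty : (K < +oo)%E by have /integrableP[] := gT.
  apply: (@le_lt_trans _ _ (\int[mu]_x (`|((f \_ I01) x)%:E| * K))%E); last first.
    rewrite ge0_integralZr//.
    - by rewrite lte_mul_pinfty ?integral_ge0//; have /integrableP[] := fT;
        rewrite ?ge0_fin_numE ?integral_ge0.
    - by apply: measurableT_comp => //; exact/measurable_EFinP.
    - exact: integral_ge0.
  apply: ge0_le_integral => //.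
  - by move=> x _; exact: integral_ge0.
  - apply: (@measurable_fun_fubini_tonelli_F _ _ _ _ _ mu (fun z => `|(F z)%:E|%E)) => //.
    by apply: measurableT_comp => //; exact/measurable_EFinP.
  - by apply: emeasurable_funM => //; apply: measurableT_comp => //; exact/measurable_EFinP.
  move=> x _; rewrite -ge0_integralZl//; last first.
    by apply: measurableT_comp => //; exact/measurable_EFinP.
  apply: ge0_le_integral => //.
  - apply: measurableT_comp => //; apply/measurable_EFinP.
    by apply: (measurableT_comp mF); exact: pair1_measurable.
  - apply: measurable_funeM; apply: measurableT_comp => //; exact/measurable_EFinP.
  - move=> y _; rewrite /F/= -EFinM lee_fin -normrM; case: ifP => // _.
    by rewrite normr0.
have := Fubini iF.
have -> : (\int[mu]_x \int[mu]_y (EFin \o F) (x, y) =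
           \int[mu]_(x in I01) (f x * prim g x)%:E)%E.
  rewrite [RHS]integral_mkcond; apply: eq_integral => x _.
  rewrite [RHS]patchE inI01; case: ifPn => x01; last first.
    apply: integral0_eq => y _; rewrite /F/= !patchE inI01 (negbTE x01).
    by rewrite mul0r if_same.
  rewrite -integral_scaled_patch//; last exact: integrable01_sub.
  apply: eq_integral => y _; rewrite /F/= -(@patch_left g x y)// !patchE (inI01 x) x01.
  by case: ifP => // _; rewrite mulr0.
have -> : (\int[mu]_y \int[mu]_x (EFin \o F) (x, y) =
           \int[mu]_(y in I01) (g y * (prim f 1 - prim f y))%:E)%E.
  rewrite [RHS]integral_mkcond; apply: eq_integral => y _.
  rewrite [RHS]patchE inI01; case: ifPn => y01; last first.
    apply: integral0_eq => x _; rewrite /F/= !patchE (inI01 y) (negbTE y01).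
    by rewrite mulr0 if_same.
  have /andP[y0 y1] := y01.
  have sub : mu.-integrable `]y, 1] (EFin \o f).
    by apply: integrableS fi => //; apply: subset_itvr; rewrite bnd_simp.
  rewrite /prim Rintegral_itvB// Rintegral_itv_obnd_cbnd//.
  rewrite -integral_scaled_patch//; last first.
    by apply: integrableS fi => //; apply: subset_itvr; rewrite bnd_simp.
  apply: eq_integral => x _; rewrite /F/= -(@patch_right f x y)// !patchE (inI01 y) y01.
  by case: ifP => // _; rewrite (mulr0, mulrC).
by rewrite /Rintegral => ->.
Qed.

Lemma integral_mul_prim f g : integrable01 f -> integrable01 g ->
  \int[mu]_(x in I01) (f x * prim g x) =
  prim f 1 * prim g 1 - \int[mu]_(x in I01) (prim f x * g x).
Proof.
move=> fi gi; rewrite triangle_fubini//.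
have -> : prim f 1 * prim g 1 = \int[mu]_(x in I01) (prim f 1 * g x).
  by rewrite RintegralZl.
rewrite -RintegralB//.
- by apply: eq_Rintegral => x _; ring.
- exact: integrable01Z.
- apply: bounded_mul_integrable01 => //; first exact: prim_measurable.
  exact: prim_bounded.
Qed.

End IntegrationByParts.

(** * The Dirichlet problem with a bounded potential *)

Section Volterra.
Context {R : realType}.
Notation mu := (@lebesgue_measure R).
Notation I01 := (`[0, 1]%classic : set R).
Implicit Types (f g h p : R -> R) (x : R).
Hint Resolve measurable01 : core.

Lemma scaled_exp_integrable01 (K lam : R) :
  integrable01 (fun z => K * expR (lam * z)).
Proof.
apply: integrable01Z; apply: bounded_integrable01.
  apply: measurableT_comp; first exact: measurable_expR.
  exact: measurable_funM.
exists (expR `|lam|) => x /andP[x0 x1].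
rewrite ger0_norm ?expR_ge0// ler_expR (le_trans (ler_norm _))// normrM.
by rewrite ler_piMr// ger0_norm.
Qed.

Lemma prim_scaled_exp (K lam x : R) : lam != 0 -> 0 <= x <= 1 ->
  prim (fun z => K * expR (lam * z)) x = K / lam * (expR (lam * x) - 1).
Proof.
move=> lam0 x01; have /andP[] := x01; rewrite le_eqVlt => /predU1P[<- _|x0 _].
  by rewrite prim0 mulr0 expR0 subrr mulr0.
pose F z := K / lam * expR (lam * z).
have dF z : is_derive z (1 : R) F (K * expR (lam * z)).
  rewrite /F; apply: is_derive_eq.
  by rewrite /GRing.scale/=; field.
have cF z : {for z, continuous F}.
  by apply/differentiable_continuous/derivable1_diffP; have [] := dF z.
rewrite /prim /Rintegral (@continuous_FTC2 _ _ F)//.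
- by rewrite /F /= mulr0 expR0; ring.
- apply: continuous_subspaceT => z; apply: cvgMl_tmp.
  by apply: continuous_comp; [exact: mulrl_continuous|exact: continuous_expR].
- split.
  + by move=> z _; have [] := dF z.
  + exact/cvg_at_right_filter/cF.
  + exact/cvg_at_left_filter/cF.
- by move=> z _; rewrite derive1E; have := dF z => ?; rewrite derive_val.
Qed.

Section MonotoneIteration.
Variables (p b : R -> R) (P B : R).
Hypothesis mp : measurable_fun I01 p.
Hypothesis p0P : forall x, 0 <= x <= 1 -> 0 <= p x <= P.
Hypothesis mb : measurable_fun I01 b.
Hypothesis b0B : forall x, 0 <= x <= 1 -> 0 <= b x <= B.

Let P_ge0 : 0 <= P.
Proof.
have /p0P/andP[] : 0 <= (0 : R) <= 1 by rewrite lexx ler01.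
exact: le_trans.
Qed.

Let B_ge0 : 0 <= B.
Proof.
have /b0B/andP[] : 0 <= (0 : R) <= 1 by rewrite lexx ler01.
exact: le_trans.
Qed.

Let lam := 1 + P.
Let lam_gt0 : 0 < lam. Proof. by rewrite ltr_pwDl. Qed.

Let S_ n := iter n (fun s x => b x + prim (prim (fun z => p z * s z)) x) (cst 0).

Let S_S n x : S_ n.+1 x = b x + prim (prim (fun z => p z * S_ n z)) x.
Proof. by []. Qed.

(** The weight [exp ((1 + P) x)] is a supersolution, because
    [P / (1 + P) ^ 2 <= 1]. *)
Let S_bounds n : measurable_fun I01 (S_ n) /\
  forall x, 0 <= x <= 1 -> 0 <= S_ n x <= B * expR (lam * x).
Proof.
elim: n => [|n [mS SB]].
  split; first exact: measurable_cst.
  by move=> x x01; have -> : S_ 0 x = 0 by []; rewrite lexx mulr_ge0 ?expR_ge0.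
have iS : integrable01 (fun z => p z * S_ n z).
  apply: (@dominated_integrable01 _ _ (fun x => P * B * expR (lam * x))).
  - exact: measurable_funM.
  - exact: scaled_exp_integrable01.
  - move=> x x01; have /andP[p0 pP] := p0P x01; have /andP[s0 sB] := SB _ x01.
    by rewrite ger0_norm ?mulr_ge0// -mulrA ler_pM.
split.
  change (measurable_fun I01 (b \+ prim (prim (fun z => p z * S_ n z)))).
  apply: measurable_funD; first exact: mb.
  by apply: prim_measurable; exact: prim_integrable.
move=> x x01; have /andP[b0 bB] := b0B x01; rewrite S_S.
have pos z : 0 <= z <= 1 -> 0 <= prim (fun z => p z * S_ n z) z.
  move=> z01; apply: prim_ge0 => // y y01.
  have /andP[p0 _] := p0P y01; have /andP[s0 _] := SB _ y01.
  exact: mulr_ge0.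
rewrite addr_ge0//=; last exact: prim_ge0.
have lam0 : lam != 0 by rewrite gt_eqF.
apply: (@le_trans _ _ (B + prim (fun z => P * B / lam * expR (lam * z)) x)).
  rewrite lerD// le_prim//; first exact: prim_integrable.
    exact: scaled_exp_integrable01.
  (* the subtracted constant is dropped after each of the two integrations *)
  move=> z z01; apply: (@le_trans _ _ (prim (fun z => P * B * expR (lam * z)) z)).
    apply: le_prim => //; first exact: scaled_exp_integrable01.
    move=> y y01; have /andP[p0 pP] := p0P y01; have /andP[s0 sB] := SB _ y01.
    by rewrite -mulrA ler_pM.
  rewrite prim_scaled_exp// ler_wpM2l ?gerBl//.
  by apply: divr_ge0; [exact: mulr_ge0|exact: ltW].
rewrite prim_scaled_exp//.
have e1 : 0 <= expR (lam * x) - 1.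
  rewrite subr_ge0 -expR0 ler_expR mulr_ge0 ?(ltW lam_gt0)//.
  by case/andP: x01.
have -> : B * expR (lam * x) = B + B * (expR (lam * x) - 1) by ring.
rewrite lerD2l ler_wpM2r// -mulrA -invfM ler_pdivrMr ?mulr_gt0//.
rewrite mulrC ler_wpM2l// /lam.
by have := P_ge0; nra.
Qed.

Let S_integrable n : integrable01 (fun z => p z * S_ n z).
Proof.
have [mS SB] := S_bounds n; apply: bounded_mul_integrable01 => //.
  by exists P => x /p0P/andP[p0 pP]; rewrite ger0_norm.
apply: (@dominated_integrable01 _ _ (fun x => B * expR (lam * x))) => //.
  exact: scaled_exp_integrable01.
by move=> x /SB/andP[s0 sB]; rewrite ger0_norm.
Qed.

Let S_increasing n x : 0 <= x <= 1 -> S_ n x <= S_ n.+1 x.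
Proof.
elim: n x => [|n IH] x x01.
  by have [_ /(_ x x01)/andP[]] := S_bounds 1.
rewrite 2!S_S lerD2l; apply: le_prim => //; try exact: prim_integrable.
move=> z z01; apply: le_prim => // y y01.
by rewrite ler_wpM2l ?IH//; have /andP[] := p0P y01.
Qed.

(** As [p >= 0], the iterates starting from [0] increase; they are bounded by the
    supersolution, and dominated convergence shows that their limit solves the
    equation. *)
Lemma volterra_solution : exists z : R -> R,
  [/\ measurable_fun I01 z, bounded01 z,
      (forall x, 0 <= x <= 1 -> b x <= z x) &
      forall x, 0 <= x <= 1 -> z x = b x + prim (prim (fun y => p y * z y)) x].
Proof.
pose C := B * expR lam.
have SC n x : 0 <= x <= 1 -> `|S_ n x| <= C.
  move=> x01; have [_ /(_ x x01)/andP[s0 sB]] := S_bounds n.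
  rewrite ger0_norm// (le_trans sB)// ler_wpM2l// ler_expR ler_piMr ?(ltW lam_gt0)//.
  by case/andP: x01.
have mS n : measurable_fun I01 (S_ n) by have [] := S_bounds n.
pose z x := limn (S_ ^~ x).
have Sz x : 0 <= x <= 1 -> S_ n x @[n --> \oo] --> z x.
  move=> x01; apply: nondecreasing_is_cvgn.
    by apply/nondecreasing_seqP => n; exact: S_increasing.
  exists C => _ [n _ <-]; exact: le_trans (ler_norm _) (SC n x x01).
have zE x : 0 <= x <= 1 -> z x = b x + prim (prim (fun y => p y * z y)) x.
  move=> x01.
  have mpS n : measurable_fun I01 (fun y => p y * S_ n y) by exact: measurable_funM.
  have pSC n y : 0 <= y <= 1 -> `|p y * S_ n y| <= P * C.
    move=> y01; rewrite normrM ler_pM ?SC//.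
    by have /andP[p0 pP] := p0P y01; rewrite ger0_norm.
  have pSz y : 0 <= y <= 1 -> p y * S_ n y @[n --> \oo] --> p y * z y.
    by move=> y01; apply: cvgMl_tmp; exact: Sz.
  have c2 : prim (prim (fun y => p y * S_ n y)) x @[n --> \oo] -->
      prim (prim (fun y => p y * z y)) x.
    apply: (@prim_cvg _ _ _ (P * C)) => //.
    - by move=> n; exact: prim_measurable.
    - by move=> n y y01; apply: le_norm_prim => // t; exact: pSC.
    - by move=> y y01; exact: (prim_cvg mpS pSC pSz).
  have c1 : S_ n.+1 x @[n --> \oo] --> b x + prim (prim (fun y => p y * z y)) x.
    by apply: cvgD; [exact: cvg_cst|exact: c2].
  have := Sz x x01; rewrite -(cvg_shiftS (S_ ^~ x)) => c3.
  exact: (cvg_unique _ c3 c1).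
exists z; split => //.
- exact: (bounded_limit_measurable mS Sz).
- by exists C; exact: (bounded_limit_bounded SC Sz).
- move=> x x01; rewrite zE// lerDl; apply: prim_ge0 => // y y01.
  apply: prim_ge0 => // t t01; rewrite mulr_ge0//.
    by have /andP[] := p0P t01.
  apply: (ler_cvg_to (cvg_cst 0) (Sz t t01)); apply: nearW => n.
  by have [_ /(_ t t01)/andP[]] := S_bounds n.
Qed.

End MonotoneIteration.
End Volterra.

Section DirichletProblem.
Context {R : realType}.
Notation mu := (@lebesgue_measure R).
Notation I01 := (`[0, 1]%classic : set R).
Implicit Types (f g h p : R -> R) (x : R).
Hint Resolve measurable01 : core.

Lemma prim2D f g x : integrable01 f -> integrable01 g -> 0 <= x <= 1 ->
  prim (prim (fun z => f z + g z)) x = prim (prim f) x + prim (prim g) x.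
Proof.
move=> fi gi x01; rewrite -primD//; try exact: prim_integrable.
by apply: eq_prim => // z z01; rewrite primD.
Qed.

Lemma prim2Z (c : R) f x : integrable01 f -> 0 <= x <= 1 ->
  prim (prim (fun z => c * f z)) x = c * prim (prim f) x.
Proof.
move=> fi x01; rewrite -primZ//; try exact: prim_integrable.
by apply: eq_prim => // z z01; rewrite primZ.
Qed.

(** [f] is the continuous representative of an element of the intersection of
    H^2 and H^1_0, with second derivative [f2] and slope [c] at [0]. *)
Definition dirichlet_slope (c : R) f f2 := [/\ sqint f2,
  (forall x, 0 <= x <= 1 -> f x = prim (fun z => c + prim f2 z) x) & f 1 = 0].

Definition dirichlet f f2 := exists c : R, dirichlet_slope c f f2.

Lemma slope_integrable (c : R) f2 : integrable01 f2 ->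
  integrable01 (fun z => c + prim f2 z).
Proof.
by move=> fi; apply: (integrable01D (integrable01_cst c)); exact: prim_integrable.
Qed.

Lemma eq_measurable01 f g : (forall x, 0 <= x <= 1 -> f x = g x) ->
  measurable_fun I01 f -> measurable_fun I01 g.
Proof.
by move=> fg; apply: eq_measurable_fun => x; rewrite inI01; exact: fg.
Qed.

Lemma dirichlet_measurable f f2 : dirichlet f f2 -> measurable_fun I01 f.
Proof.
move=> [c [/sqint_integrable fi fE _]].
apply: (@eq_measurable01 (prim (fun z => c + prim f2 z))).
  by move=> x /fE.
by apply: prim_measurable; exact: slope_integrable.
Qed.

Lemma dirichlet_bounded f f2 : dirichlet f f2 -> bounded01 f.
Proof.
move=> [c [/sqint_integrable fi fE _]].
have [C fC] := prim_bounded (slope_integrable c fi).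
by exists C => x x01; rewrite fE// fC.
Qed.

Lemma dirichlet_lin (c : R) f f2 g g2 : dirichlet f f2 -> dirichlet g g2 ->
  dirichlet (fun x => c * f x + g x) (fun x => c * f2 x + g2 x).
Proof.
move=> [a [sf fE f1]] [b [sg gE g1]].
have fi := sqint_integrable sf; have gi := sqint_integrable sg.
exists (c * a + b); split; first exact: sqint_lin.
  2: by rewrite f1 g1 mulr0 addr0.
move=> x x01; rewrite fE// gE// -primZ ?slope_integrable//.
rewrite -primD ?integrable01Z ?slope_integrable//.
by apply: eq_prim => // z z01; rewrite primD ?primZ ?integrable01Z//; ring.
Qed.

(** Since [h] vanishes at both ends, integration by parts pairs [- f2] with [h]
    through the product of the first derivatives, which is symmetric, and
    nonnegative when [h = f]. *)
Lemma dirichlet_energy a b f f2 h h2 :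
  dirichlet_slope a f f2 -> dirichlet_slope b h h2 ->
  \int[mu]_(x in I01) (f2 x * h x) =
  - \int[mu]_(x in I01) ((a + prim f2 x) * (b + prim h2 x)).
Proof.
move=> [sf fE f1] [sh hE h1].
have fi := sqint_integrable sf; have hi := sqint_integrable sh.
have si := slope_integrable b hi.
have i1 : 0 <= (1 : R) <= 1 by rewrite ler01 lexx.
have e : prim (fun z => b + prim h2 z) 1 = 0 by rewrite -hE.
have -> : \int[mu]_(x in I01) (f2 x * h x) =
    \int[mu]_(x in I01) (f2 x * prim (fun z => b + prim h2 z) x).
  by apply: eq_Rintegral => x; rewrite inI01 => /hE ->.
rewrite integral_mul_prim// e mulr0 sub0r; congr (- _).
have pi : integrable01 (fun x => prim f2 x * (b + prim h2 x)).
  by apply: bounded_mul_integrable01 => //; [exact: prim_measurable|exact: prim_bounded].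
under [RHS]eq_Rintegral do rewrite mulrDl.
rewrite RintegralD//; last exact: integrable01Z.
by rewrite RintegralZl// (_ : \int[mu]_(x in I01) (b + prim h2 x) = 0) ?mulr0 ?add0r.
Qed.

(** Shooting: [zm - zp] solves the equation with zero value and slope at [0], and
    [phi] solves the homogeneous equation with value [0] and slope [1] there.
    Since [phi x >= x], a multiple of [phi] corrects the value at [1].  The
    Volterra equation is solved for the positive and negative parts of [h]
    separately because its iteration is monotone. *)
Lemma dirichlet_onto p (P : R) h : measurable_fun I01 p ->
  (forall x, 0 <= x <= 1 -> 0 <= p x <= P) -> sqint h ->
  exists f f2, dirichlet f f2 /\
    forall x, 0 <= x <= 1 -> - f2 x + p x * f x = h x.
Proof.
move=> mp p0P sh; have hi := sqint_integrable sh.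
pose hp x := 2^-1 * (`|h x| + h x).
pose hm x := 2^-1 * (`|h x| + -1 * h x).
have hpi : integrable01 hp.
  by apply: integrable01Z; apply: integrable01D => //; exact: integrable01_norm.
have hmi : integrable01 hm.
  apply: integrable01Z; apply: integrable01D; first exact: integrable01_norm.
  exact: integrable01Z.
have hp0 x : 0 <= hp x by rewrite mulr_ge0//; have := lerNnormlW (lexx `|h x|); lra.
have hm0 x : 0 <= hm x by rewrite mulr_ge0//; have := ler_norm (h x); lra.
have hE x : h x = hp x - hm x by rewrite /hp /hm; field.
clearbody hp hm.
have pbnd : bounded01 p by exists P => x /p0P/andP[p0 pP]; rewrite ger0_norm.
have solve k : integrable01 k -> (forall x, 0 <= k x) ->
    exists z, [/\ integrable01 (fun y => p y * z y), measurable_fun I01 z &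
      forall x, 0 <= x <= 1 -> z x = prim (prim k) x + prim (prim (fun y => p y * z y)) x].
  move=> ki k0; have [C kC] := prim_bounded (prim_integrable ki).
  have bC x : 0 <= x <= 1 -> 0 <= prim (prim k) x <= C.
    move=> x01; rewrite prim_ge0//=; last by move=> z z01; exact: prim_ge0.
    exact: le_trans (ler_norm _) (kC x x01).
  have [z [mz bz _ zE]] := volterra_solution mp p0P
    (prim_measurable (prim_integrable ki)) bC.
  exists z; split => //; apply: bounded_mul_integrable01 => //.
  exact: bounded_integrable01.
have [zp [zpi mzp zpE]] := solve hp hpi hp0.
have [zm [zmi mzm zmE]] := solve hm hmi hm0.
have [phi [mphi bphi phi_ge phiE]] := @volterra_solution _ p id P 1 mp p0P
  (@measurable_id _ _ _) (fun x x01 => x01).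
have phii : integrable01 (fun y => p y * phi y).
  by apply: bounded_mul_integrable01 => //; exact: bounded_integrable01.
have i1 : 0 <= (1 : R) <= 1 by rewrite ler01 lexx.
have phi1 : phi 1 != 0 by rewrite gt_eqF// (lt_le_trans ltr01)// phi_ge.
pose al := - (zm 1 - zp 1) / phi 1.
pose f x := zm x + (-1 * zp x + al * phi x).
pose f2 x := p x * f x + -1 * h x.
have f2E x : f2 x = p x * zm x + (-1 * (p x * zp x) + (al * (p x * phi x) +
    (hm x + -1 * hp x))).
  by rewrite /f2 /f hE; ring.
have iZ c k : integrable01 k -> integrable01 (fun x => c * k x) by exact: integrable01Z.
have iD := @integrable01D R.
have f2i : integrable01 f2 by rewrite (funext f2E); auto 9.
have fE x : 0 <= x <= 1 -> f x = prim (fun z => al + prim f2 z) x.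
  move=> x01.
  rewrite (primD (integrable01_cst al))//; last exact: prim_integrable.
  rewrite prim_cst// (funext f2E).
  rewrite !prim2D ?prim2Z//; try by auto 9.
  rewrite /f zmE// zpE// phiE//=.
  set A := prim (prim (fun y => p y * zm y)) x.
  set B := prim (prim (fun y => p y * zp y)) x.
  set C := prim (prim (fun y => p y * phi y)) x.
  by move: A B C (prim (prim hm) x) (prim (prim hp) x) => A B C D E; ring.
have mf : measurable_fun I01 f.
  by apply: measurable_funD => //; apply: measurable_funD; exact: measurable_funM.
have bf : bounded01 f.
  have [C fC] := prim_bounded (slope_integrable al f2i).
  by exists C => x x01; rewrite fE// fC.
exists f, f2; split; last by move=> x _; rewrite /f2; ring.
exists al; split => //.
  have sf : sqint (fun x => -1 * h x + p x * f x).
    by apply: sqint_lin => //; apply: bounded_mul_sqint => //; exact: bounded_sqint.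
  rewrite (_ : f2 = fun x => -1 * h x + p x * f x)//.
  by apply/funext => x; rewrite addrC.
by rewrite /f /al; field.
Qed.

End DirichletProblem.

(** * The Schroedinger operator on square integrable functions *)

Section SquareIntegrableSpace.
Context {R : realType}.
Notation mu := (@lebesgue_measure R).
Notation I01 := (`[0, 1]%classic : set R).
Hint Resolve measurable01 : core.

Definition sqint_pred : {pred (R -> R)} := fun f => `[< sqint f >].

Record L2fun := MkL2 { L2val :> R -> R ; L2valP : L2val \in sqint_pred }.

HB.instance Definition _ := [isSub for L2val].
HB.instance Definition _ := [Choice of L2fun by <:].

Lemma sqint_submod_closed : submod_closed sqint_pred.
Proof.
split=> [|c f g /asboolP sf /asboolP sg]; apply/asboolP.
  apply: bounded_sqint; first exact: measurable_cst.
  by exists 0 => x _; rewrite normr0.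
exact: sqint_lin.
Qed.

HB.instance Definition _ := GRing.isSubmodClosed.Build R (R -> R) sqint_pred
  sqint_submod_closed.
HB.instance Definition _ := [SubChoice_isSubLmodule of L2fun by <:].

Implicit Types f g h : L2fun.

Lemma L2funP f : sqint f. Proof. by apply/asboolP/L2valP. Qed.

Definition L2ip f g : R := \int[mu]_(x in I01) (f x * g x).

Lemma L2ipC f g : L2ip f g = L2ip g f.
Proof. by apply: eq_Rintegral => x _; rewrite mulrC. Qed.

Lemma L2ip_lin (c : R) f g h : L2ip (c *: f + g) h = c * L2ip f h + L2ip g h.
Proof.
have fh := sqint_mul_integrable (L2funP f) (L2funP h).
have gh := sqint_mul_integrable (L2funP g) (L2funP h).
rewrite /L2ip -RintegralZl// -RintegralD//; last exact: integrable01Z.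
by apply: eq_Rintegral => x _; rewrite mulrA -mulrDl.
Qed.

Lemma L2ip_ge0 f : 0 <= L2ip f f.
Proof. by apply: Rintegral_ge0 => x _; rewrite -expr2 sqr_ge0. Qed.

(** A complex valued function is the pair of its real and imaginary parts; [rot]
    is then the multiplication by the imaginary unit. *)
Definition L2pair : Type := (L2fun * L2fun)%type.
HB.instance Definition _ := GRing.Lmodule.on L2pair.

Definition ip2 (u v : L2pair) : R := L2ip u.1 v.1 + L2ip u.2 v.2.

Lemma ip2C u v : ip2 u v = ip2 v u.
Proof. by rewrite /ip2 L2ipC (L2ipC u.2). Qed.

Lemma ip2_lin (c : R) u v w : ip2 (c *: u + v) w = c * ip2 u w + ip2 v w.
Proof. by rewrite /ip2/= !L2ip_lin; ring. Qed.

Lemma ip2_ge0 u : 0 <= ip2 u u.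
Proof. by rewrite addr_ge0 ?L2ip_ge0. Qed.

Definition rot (u : L2pair) : L2pair := (- u.2, u.1).

Lemma rot_linear : linear rot.
Proof.
by move=> c u v; rewrite /rot /= opprD -scalerN.
Qed.

HB.instance Definition _ := GRing.isLinear.Build R L2pair L2pair *:%R rot
  rot_linear.

Lemma L2ipNl f g : L2ip (- f) g = - L2ip f g.
Proof. exact: (ipNl L2ip_lin). Qed.

Lemma L2ipNr f g : L2ip g (- f) = - L2ip g f.
Proof. exact: (ipNr L2ipC L2ip_lin). Qed.

Lemma rot_isometry u v : ip2 (rot u) (rot v) = ip2 u v.
Proof. by rewrite /ip2/= L2ipNl L2ipNr opprK addrC. Qed.

Lemma rot_skew u v : ip2 (rot u) v = - ip2 u (rot v).
Proof. by rewrite /ip2/= L2ipNl L2ipNr opprD opprK addrC. Qed.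

Section Potential.
Variables (p : R -> R) (Q : R).
Hypothesis mp : measurable_fun I01 p.
Hypothesis pQ : forall x : R, 0 <= x <= 1 -> `|p x| <= Q.

Definition schroedinger f g := exists f2 : R -> R, dirichlet f f2 /\
  forall x : R, 0 <= x <= 1 -> g x = - f2 x + p x * f x.

Lemma schroedinger_lin (c : R) f f' g g' :
  schroedinger f f' -> schroedinger g g' -> schroedinger (c *: f + g) (c *: f' + g').
Proof.
move=> [f2 [df fE]] [g2 [dg gE]]; exists (fun x => c * f2 x + g2 x); split.
  exact: (dirichlet_lin c df dg).
move=> x x01; rewrite /= [LHS](_ : _ = c * f' x + g' x)//.
rewrite [X in p x * X](_ : _ = c * f x + g x)// fE// gE//.
by ring.
Qed.

Let pbnd : bounded01 p. Proof. by exists Q. Qed.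

Let potential_integrable f g : integrable01 (fun x => p x * f x * g x).
Proof.
apply: sqint_mul_integrable (L2funP g).
by apply: bounded_mul_sqint => //; exact: L2funP.
Qed.

Lemma schroedinger_form f f' g (f2 : R -> R) : dirichlet f f2 ->
  (forall x : R, 0 <= x <= 1 -> f' x = - f2 x + p x * f x) ->
  L2ip f' g = - (\int[mu]_(x in I01) (f2 x * g x)) +
    \int[mu]_(x in I01) (p x * f x * g x).
Proof.
move=> [c [sf2 _ _]] fE.
have fg := sqint_mul_integrable sf2 (L2funP g).
rewrite -mulN1r -RintegralZl// -RintegralD//; [|exact: integrable01Z|exact: potential_integrable].
by apply: eq_Rintegral => x; rewrite inI01 => /fE ->; ring.
Qed.

Lemma schroedinger_sym f f' g g' :
  schroedinger f f' -> schroedinger g g' -> L2ip f' g = L2ip f g'.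
Proof.
move=> [f2 [df fE]] [g2 [dg gE]]; rewrite (L2ipC f).
rewrite (schroedinger_form g df fE) (schroedinger_form f dg gE).
have [a sa] := df; have [b sb] := dg.
rewrite (dirichlet_energy sa sb) (dirichlet_energy sb sa) !opprK.
congr (_ + _); apply: eq_Rintegral => x _; first exact: mulrC.
by rewrite mulrAC.
Qed.

Lemma schroedinger_below f f' : schroedinger f f' -> - Q * L2ip f f <= L2ip f' f.
Proof.
move=> [f2 [df fE]]; rewrite (schroedinger_form f df fE).
have [a sa] := df; rewrite (dirichlet_energy sa sa) opprK.
have ff := sqint_mul_integrable (L2funP f) (L2funP f).
rewrite -RintegralZl// -[leLHS]add0r lerD//.
  by apply: Rintegral_ge0 => x _; rewrite -expr2 sqr_ge0.
apply: le_Rintegral => //; [exact: integrable01Z|exact: potential_integrable|].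
move=> x; rewrite I01E => x01; rewrite -mulrA ler_wpM2r -?expr2 ?sqr_ge0//.
by have := pQ x01; rewrite ler_norml => /andP[].
Qed.

(** The potential [p + m] is nonnegative because [m > Q]. *)
Lemma schroedinger_onto (m : R) h : Q < m ->
  exists f f', schroedinger f f' /\ f' + m *: f = h.
Proof.
move=> Qm.
have [|||f [f2 [df fE]]] := @dirichlet_onto _ (fun x => p x + m) (Q + m) h.
- exact: measurable_funD.
- move=> x x01; have := pQ x01; rewrite ler_norml => /andP[lo up].
  by apply/andP; split; lra.
- exact: L2funP.
have sf : f \in sqint_pred.
  apply/asboolP/bounded_sqint; first exact: dirichlet_measurable df.
  exact: dirichlet_bounded df.
pose F := MkL2 sf; exists F, (h - m *: F); split; last by rewrite subrK.
exists f2; split=> // x x01.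
rewrite [LHS](_ : _ = h x - m * f x)// -fE//.
by rewrite [X in p x * X](_ : _ = f x)//; ring.
Qed.

Definition schroedinger2 (u v : L2pair) :=
  schroedinger u.1 v.1 /\ schroedinger u.2 v.2.

Lemma schroedinger2_lin : graph_linear schroedinger2.
Proof.
by move=> c f f' g g' [? ?] [? ?]; split; exact: schroedinger_lin.
Qed.

Lemma schroedinger2_sym : graph_symmetric ip2 schroedinger2.
Proof.
by move=> f f' g g' [? ?] [? ?]; congr (_ + _); exact: schroedinger_sym.
Qed.

Lemma schroedinger2_rot : graph_commutes rot schroedinger2.
Proof.
move=> f f' [h1 h2]; split=> //=.
have := schroedinger_lin (-2) h2 h2.
rewrite -{2}[f.2]scale1r -{2}[f'.2]scale1r -!scalerDl.
by rewrite (_ : -2 + 1 = -1 :> R) ?scaleN1r//; ring.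
Qed.

Lemma schroedinger2_below : graph_bounded_below ip2 schroedinger2 Q.
Proof.
by move=> f f' [h1 h2]; rewrite /ip2 mulrDr lerD// schroedinger_below.
Qed.

Lemma schroedinger2_onto : graph_shift_onto schroedinger2 Q.
Proof.
move=> m Qm h.
have [f [f' [h1 e1]]] := schroedinger_onto h.1 Qm.
have [g [g' [h2 e2]]] := schroedinger_onto h.2 Qm.
exists (f, g), (f', g'); split=> //.
by rewrite [LHS](_ : _ = (f' + m *: f, g' + m *: g))// e1 e2; case: h {e1 e2}.
Qed.

End Potential.
End SquareIntegrableSpace.

(** * Norms of complex valued functions *)

Section Norms.
Context {R : realType}.
Notation mu := (@lebesgue_measure R).
Notation I01 := (`[0, 1]%classic : set R).
Notation Re := complex.Re.
Notation Im := complex.Im.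
Hint Resolve measurable01 : core.
Implicit Types (f g : R -> R[i]) (x : R).

Lemma cabsE (z : R[i]) : cabs z = Num.sqrt (Re z ^+ 2 + Im z ^+ 2).
Proof. by case: z. Qed.

Lemma measurable_open_closed01 (h : R -> R) :
  measurable_fun (`]0, 1[ : set R) h <-> measurable_fun I01 h.
Proof.
split.
  move=> mh; apply/measurable_fun_itv_obnd_cbndP.
  exact/measurable_fun_itv_bndo_bndcP.
by apply: measurable_funS => // x; rewrite /= !in_itv/= => /andP[? ?]; rewrite !ltW.
Qed.

Lemma integral_open_closed01 (h : R -> \bar R) : measurable_fun I01 h ->
  (\int[mu]_(x in `]0%R, 1%R[) h x = \int[mu]_(x in `[0%R, 1%R]) h x)%E.
Proof.
move=> mh.
have sub (i : interval R) : [set` i] `<=` I01 -> measurable_fun [set` i] h.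
  by move=> iI; exact: measurable_funS mh.
rewrite integral_itv_bndo_bndc; last by apply: sub; apply: subset_itvW.
rewrite integral_itv_obnd_cbnd//; apply: sub.
by apply: subset_itv; rewrite bnd_simp.
Qed.

(** Replacing by [0] a function that is not square integrable gives total
    embeddings into the spaces of square integrable functions. *)
Definition toL2 (h : R -> R) : @L2fun R := insubd 0 h.

Lemma toL2E h : sqint h -> toL2 h = h :> (R -> R).
Proof. by move=> sh; rewrite /toL2 insubdK//; exact/asboolP. Qed.

Definition toL2pair f : @L2pair R :=
  (toL2 (fun x => Re (f x)), toL2 (fun x => Im (f x))).

Lemma L2norm_int f :
  L2norm f = ((\int[mu]_(x in `]0%R, 1%R[) (Re (f x) ^+ 2 + Im (f x) ^+ 2)%:E) `^ 2^-1)%E.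
Proof.
rewrite /L2norm /Lnorm_on unlock /Lnorm; congr (_ `^ _)%E.
rewrite [RHS]integral_mkcond; apply: eq_integral => x _.
rewrite /= !patchE; case: ifP => _.
  by rewrite ger0_norm ?cabsE ?sqrtr_ge0// powR_mulrn// sqr_sqrtr ?addr_ge0 ?sqr_ge0.
by rewrite normr0 powR0.
Qed.

Lemma sqint_of_energy (h : R -> R) (e : R -> R) : measurable_fun I01 h ->
  measurable_fun I01 e -> (forall x, h x ^+ 2 <= e x) ->
  (\int[mu]_(x in `[0%R, 1%R]) (e x)%:E < +oo)%E -> sqint h.
Proof.
move=> mh me he ie; split=> //.
apply: (@dominated_integrable01 _ _ e) => //.
- exact: measurable_funX.
- apply/integrableP; split; first exact/measurable_EFinP.
  move: ie; congr (_ < _)%E; apply: eq_integral => x _ /=.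
  by rewrite ger0_norm// (le_trans _ (he x)) ?sqr_ge0.
- by move=> x _; rewrite ger0_norm ?sqr_ge0.
Qed.

Lemma inL2_sqint f : inL2 f ->
  sqint (fun x => Re (f x)) /\ sqint (fun x => Im (f x)).
Proof.
move=> [/measurable_open_closed01 mr /measurable_open_closed01 mi].
have me : measurable_fun I01 (fun x => Re (f x) ^+ 2 + Im (f x) ^+ 2).
  by apply: measurable_funD; exact: measurable_funX.
rewrite L2norm_int => /lty_poweRy; rewrite integral_open_closed01; last first.
  exact/measurable_EFinP.
move=> /(_ (lt0r_neq0 _)) H.
have ie : (\int[mu]_(x in `[0%R, 1%R]) (Re (f x) ^+ 2 + Im (f x) ^+ 2)%:E < +oo)%E.
  by apply: H; rewrite invr_gt0.
by split; apply: sqint_of_energy ie => // x; rewrite (lerDl, lerDr) sqr_ge0.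
Qed.

Notation L2nrm := (nrm (@ip2 R)).

Lemma L2norm_nrm f : sqint (fun x => Re (f x)) -> sqint (fun x => Im (f x)) ->
  L2norm f = (L2nrm (toL2pair f))%:E.
Proof.
move=> sr si; have [mr ir] := sr; have [mi ii] := si.
rewrite L2norm_int integral_open_closed01; last first.
  by apply/measurable_EFinP; apply: measurable_funD; exact: measurable_funX.
have -> : (\int[mu]_(x in I01) (Re (f x) ^+ 2 + Im (f x) ^+ 2)%:E)%E =
    (ip2 (toL2pair f) (toL2pair f))%:E.
  rewrite /ip2 /L2ip/= !toL2E// -RintegralD//.
  rewrite /Rintegral fineK; last first.
    by apply: integrable_fin_num => //; exact: (integrable01D ir ii).
  by apply: eq_integral => x _; rewrite !expr2.
by rewrite poweR_EFin powR12_sqrt// ip2_ge0.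
Qed.

Lemma inL2_norm f : inL2 f -> L2norm f = (L2nrm (toL2pair f))%:E.
Proof. by move=> /inL2_sqint[sr si]; exact: L2norm_nrm. Qed.

End Norms.

(** * From solutions to abstract evolutions *)

Section EssentialBounds.
Context {R : realType}.
Notation mu := (@lebesgue_measure R).
Implicit Types (A : set R) (f : R -> R).

Lemma smooth_on_continuous A f (x : R) : smooth_on A f -> nbhs x A ->
  {for x, continuous f}.
Proof.
move=> [g [U [oU AU fg dg]]] xA.
have Ux : U x by apply: AU; exact: nbhs_singleton xA.
have gx : {for x, continuous g}.
  by apply/differentiable_continuous/derivable1_diffP; exact: (dg 0%N x Ux).
have fgx : \near x, f x = g x by apply: filterS xA => y; exact: fg.
rewrite /prop_for /continuous_at (nbhs_singleton fgx); apply: cvg_trans gx.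
apply: near_eq_cvg; apply: filterS fgx => y ->//.
Qed.

(** A point where [|f| > M] would have a neighbourhood, hence a set of positive
    measure, on which this holds. *)
Lemma Linfty_norm_bound A f M (x : R) : nbhs x A -> {for x, continuous f} ->
  (Linfty_norm A f <= M%:E)%E -> `|f x| <= M.
Proof.
move=> xA fx; rewrite /Linfty_norm /Lnorm_on unlock /Lnorm.
case: ifPn => [_ /ess_supP [N [mN N0 sub]]|]; last first.
  move=> /negP; case; apply: (@lt_le_trans _ _ (mu `[0, 1]%classic)).
    by rewrite (measure_I01 (R := R)) lte01.
  by apply: le_measure; rewrite ?inE.
rewrite leNgt; apply/negP => Mfx.
have : nbhs x (A `&` [set y | M < `|f y|]).
  apply: filterI => //.
  exact: cvgr_gt (cvg_norm fx) _ Mfx.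
rewrite -nbhs_ballE => -[e /= e0 xeA].
have : (mu (ball x e) <= mu N)%E.
  apply: le_measure; rewrite ?inE//; first exact: measurable_ball.
  apply: subset_trans sub => y /xeA[Ay fy] /=.
  by rewrite patchE mem_set//= lee_fin leNgt fy.
rewrite N0 (lebesgue_measure_ball _ (ltW e0)) leNgt => /negP; apply.
by rewrite lte_fin pmulrn_lgt0.
Qed.

End EssentialBounds.

Section SolutionsAsEvolutions.
Context {R : realType}.
Notation mu := (@lebesgue_measure R).
Notation I01 := (`[0, 1]%classic : set R).
Notation Re := complex.Re.
Notation Im := complex.Im.
Notation L2nrm := (nrm (@ip2 R)).
Hint Resolve measurable01 : core.
Implicit Types (f g : R -> R[i]) (x : R).

Definition sqint_pair f := sqint (fun x => Re (f x)) /\ sqint (fun x => Im (f x)).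

Lemma toL2_lin (c : R) (h k : R -> R) : sqint h -> sqint k ->
  toL2 (fun x => c * h x + k x) = c *: toL2 h + toL2 k.
Proof.
move=> sh sk; apply: val_inj; apply/funext => x /=.
rewrite toL2E; last exact: sqint_lin.
by rewrite [RHS](_ : _ = c * toL2 h x + toL2 k x)// !toL2E.
Qed.

Lemma sqint_pair_lin (c : R) f g : sqint_pair f -> sqint_pair g ->
  sqint_pair (fun x => c%:C%C * f x + g x) /\
  toL2pair (fun x => c%:C%C * f x + g x) = c *: toL2pair f + toL2pair g.
Proof.
move=> [fr fi] [gr gi].
have eR x : Re (c%:C%C * f x + g x) = c * Re (f x) + Re (g x).
  by case: (f x) (g x) => [? ?] [? ?] /=; ring.
have eI x : Im (c%:C%C * f x + g x) = c * Im (f x) + Im (g x).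
  by case: (f x) (g x) => [? ?] [? ?] /=; ring.
rewrite /sqint_pair /toL2pair (funext eR) (funext eI) !toL2_lin//.
by split=> //; split; exact: sqint_lin.
Qed.

Lemma sqint_pairB f g : sqint_pair f -> sqint_pair g ->
  sqint_pair (fun x => f x - g x) /\
  toL2pair (fun x => f x - g x) = toL2pair f - toL2pair g.
Proof.
move=> sf sg; have := sqint_pair_lin (-1) sg sf.
rewrite scaleN1r addrC.
by under eq_fun do rewrite rmorphN1 mulN1r addrC.
Qed.

Lemma sqint_pairZ (c : R) f : sqint_pair f ->
  sqint_pair (fun x => c%:C%C * f x) /\
  toL2pair (fun x => c%:C%C * f x) = c *: toL2pair f.
Proof.
move=> sf; have := sqint_pair_lin (c - 1) sf sf.
have e x : (c - 1)%:C%C * f x + f x = c%:C%C * f x.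
  by rewrite rmorphB rmorph1 mulrBl mul1r subrK.
by rewrite (funext e) scalerBl scale1r subrK.
Qed.

Lemma L2ip_null (d : @L2fun R) :
  {ae mu, forall x, 0 < x < 1 -> d x = 0} -> L2ip d d = 0.
Proof.
move=> d0; have sd := L2funP d; have [md _] := sd.
rewrite /L2ip /Rintegral -integral_open_closed01; last first.
  by apply/measurable_EFinP; exact: measurable_funM.
rewrite (ae_eq_integral (cst 0%E))//.
- by rewrite integral0.
- apply/measurable_EFinP/measurable_open_closed01; exact: measurable_funM.
- move: d0; apply: filterS; first exact: (ae_filter_ringOfSetsType mu).
  move=> x dx; rewrite /= in_itv/= => /dx ->.
  by rewrite mul0r.
Qed.

Section OneTime.
Variables (q : R -> R) (Q : R).
Hypothesis mq : measurable_fun (`]0, 1[ : set R) q.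
Hypothesis qQ : forall x, 0 < x < 1 -> `|q x| <= Q.

(** A bound on the open interval says nothing about the end points, whereas the
    operators of the preceding part act on functions on the closed one. *)
Definition potential01 x := if (0 < x < 1) then q x else 0.

Lemma potential01_measurable : measurable_fun I01 potential01.
Proof.
rewrite (_ : potential01 = q \_ `]0, 1[).
  apply: measurable_funTS.
  exact: (iffLR (measurable_restrictT q (measurable_itv `]0, 1[)) mq).
by apply/funext => x; rewrite patchE mem_setE in_itv.
Qed.

Lemma potential01_bound x : 0 <= x <= 1 -> `|potential01 x| <= Q.
Proof.
move=> _; rewrite /potential01; case: ifPn => [/qQ//|_].
have h : 0 < (2^-1 : R) < 1 by apply/andP; split; lra.
by rewrite normr0 (le_trans _ (qQ h)).
Qed.

Definition schroedinger_image f f2 x := - f2 x + (potential01 x)%:C%C * f x.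

Lemma potential_sqint_pair f : sqint_pair f ->
  sqint_pair (fun x => (potential01 x)%:C%C * f x).
Proof.
have bp : bounded01 potential01 by exists Q => x; exact: potential01_bound.
move=> [fr fi]; split.
  rewrite [X in sqint X](_ : _ = fun x => potential01 x * Re (f x)).
    exact: bounded_mul_sqint potential01_measurable bp fr.
  by apply/funext => x; case: (f x) => a b /=; ring.
rewrite [X in sqint X](_ : _ = fun x => potential01 x * Im (f x)).
  exact: bounded_mul_sqint potential01_measurable bp fi.
by apply/funext => x; case: (f x) => a b /=; ring.
Qed.

Lemma schroedinger_image_sqint_pair f f2 : sqint_pair f -> sqint_pair f2 ->
  sqint_pair (schroedinger_image f f2).
Proof.
move=> sf sf2; have [+ _] := sqint_pair_lin (-1) sf2 (potential_sqint_pair sf).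
by under eq_fun do rewrite rmorphN1 mulN1r.
Qed.

Lemma H2_schroedinger f f2 : H2_with_derivative2 f f2 -> sqint_pair f ->
  f 0 = 0 -> f 1 = 0 ->
  schroedinger2 potential01 (toL2pair f) (toL2pair (schroedinger_image f f2)).
Proof.
move=> [/inL2_sqint sf2 [f1 fE]] sf f0 f10.
have [sr si] := schroedinger_image_sqint_pair sf sf2.
have [fr fi] := sf; have [f2r f2i] := sf2.
have fE1 x : 0 <= x <= 1 -> f x = cintegral `[0, x] f1.
  by move=> x01; have [-> _] := fE x x01; rewrite f0 add0r.
split.
  exists (fun x => Re (f2 x)); split; last first.
    move=> x x01; rewrite /= !toL2E// /schroedinger_image.
    by case: (f2 x) (f x) => ? ? [? ?] /=; ring.
  exists (Re (f1 0)); split=> //; last by rewrite /= toL2E// f10.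
  move=> x x01; rewrite /= toL2E// fE1//.
  apply: eq_prim => // z z01; have [_ ->] := fE z z01.
  by rewrite /cintegral; case: (f1 0).
exists (fun x => Im (f2 x)); split; last first.
  move=> x x01; rewrite /= !toL2E// /schroedinger_image.
  by case: (f2 x) (f x) => ? ? [? ?] /=; ring.
exists (Im (f1 0)); split=> //; last by rewrite /= toL2E// f10.
move=> x x01; rewrite /= toL2E// fE1//.
apply: eq_prim => // z z01; have [_ ->] := fE z z01.
by rewrite /cintegral; case: (f1 0).
Qed.

End OneTime.

Section WholeEvolution.
Variables (T : R) (a q : R -> R) (Q : R) (u0 : R -> R[i]) (u : R -> R -> R[i]).
Hypothesis mq : measurable_fun (`]0, 1[ : set R) q.
Hypothesis qQ : forall x, 0 < x < 1 -> `|q x| <= Q.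

Lemma L2norm_cvg0 (F : set_system R) (FF : Filter F) (v : R -> R -> R[i])
    (w : R -> @L2pair R) :
  (\forall s \near F, L2norm (v s) = (L2nrm (w s))%:E) ->
  L2norm (v s) @[s --> F] --> 0%E -> L2nrm (w s) @[s --> F] --> (0 : R).
Proof.
move=> vw v0.
have : (L2nrm (w s))%:E @[s --> F] --> 0%E.
  by apply: cvg_trans v0; apply: near_eq_cvg; apply: filterS vw => s ->.
exact: fine_cvg.
Qed.

(** The equation holds almost everywhere in space, so the time derivative and
    the rotated image of the operator differ by a null element, which the
    seminorm does not see. *)
Lemma solution_evolves : solves T a q u0 u -> exists uxx : R -> R -> R[i],
  [/\ forall t : R, 0 <= t <= T -> sqint_pair (u t),
      forall t : R, 0 <= t <= T -> H2_with_derivative2 (u t) (uxx t) &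
      evolves (@ip2 R) (@rot R) (schroedinger2 (potential01 q)) T a
        (fun t => toL2pair (u t))
        (fun t => toL2pair (schroedinger_image q (u t) (uxx t)))].
Proof.
move=> [cu [ut [uxx [du Hu eq_u _ bu]]]]; exists uxx.
have su t : 0 <= t <= T -> sqint_pair (u t).
  by move=> /cu[/inL2_sqint].
split=> //; split.
- move=> t tT; have [_ ct] := cu t tT; apply: L2norm_cvg0 ct.
  near=> s.
  have sT : 0 <= s <= T.
    have : s \in `[0, T] by near: s; exact: withinT.
    by rewrite in_itv.
  have [[sr si] <-] := sqint_pairB (su s sT) (su t tT).
  exact: L2norm_nrm.
- move=> t tT; have [ut0 ut1] := bu t tT.
  by apply: H2_schroedinger mq qQ _ _ (Hu t tT) (su t tT) ut0 ut1.
- move=> t tT0; have tT : 0 <= t <= T by have /andP[? ?] := tT0; rewrite !ltW.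
  have [iut dt] := du t tT; have sut := inL2_sqint iut.
  set g := toL2pair (schroedinger_image _ _ _).
  have nearT : \forall s \near t^', 0 <= s <= T.
    apply: nbhs_dnbhs; have : t \in `]0, T[ by rewrite in_itv.
    move=> /near_in_itvoo; apply: filterS => s.
    by rewrite in_itv/= => /andP[? ?]; rewrite !ltW.
  have dt' : curve_derivative (@ip2 R) (fun t => toL2pair (u t)) (toL2pair (ut t)) t.
    have sub : t^' `=>` within `[0, T] (t^').
      move=> A /= wA; apply: filterS2 nearT wA => s sT; apply.
      by rewrite /= in_itv.
    apply: L2norm_cvg0 (cvg_trans (cvg_app _ sub) dt).
    apply: filterS nearT => s sT.
    have [sB <-] := sqint_pairB (su s sT) (su t tT).
    have [sZ <-] := sqint_pairZ (s - t)^-1 sB.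
    have [[sr si] <-] := sqint_pairB sZ sut.
    exact: L2norm_nrm.
  have null : L2nrm (toL2pair (ut t) - a t *: rot g) = 0.
    have [gr gi] := schroedinger_image_sqint_pair mq qQ (su t tT)
      (inL2_sqint (Hu t tT).1).
    have [utr uti] := sut.
    have ae_eq : {ae mu, forall x, 0 < x < 1 ->
        Re (ut t x) = - a t * Im (schroedinger_image q (u t) (uxx t) x) /\
        Im (ut t x) = a t * Re (schroedinger_image q (u t) (uxx t) x)}.
      have := eq_u t tT; apply: filterS; first exact: (ae_filter_ringOfSetsType mu).
      move=> x h x01; move: (h x01); rewrite /schroedinger_image /potential01 x01.
      case: (ut t x) (uxx t x) (u t x) => [c d] [e f] [k l] /= => -[].
      by move=> h1 h2; split; lra.
    rewrite /nrm (_ : ip2 _ _ = 0) ?sqrtr0// /ip2.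
    rewrite !L2ip_null ?addr0//.
      move: ae_eq; apply: filterS; first exact: (ae_filter_ringOfSetsType mu).
      move=> x h /h[_ e].
      rewrite [LHS](_ : _ = toL2 (fun x => Im (ut t x)) x -
        a t * toL2 (fun x => Re (schroedinger_image q (u t) (uxx t) x)) x)//.
      by rewrite !toL2E// e subrr.
    move: ae_eq; apply: filterS; first exact: (ae_filter_ringOfSetsType mu).
    move=> x h /h[e _].
    rewrite [LHS](_ : _ = toL2 (fun x => Re (ut t x)) x -
      a t * - toL2 (fun x => Im (schroedinger_image q (u t) (uxx t) x)) x)//.
    by rewrite !toL2E// e; ring.
  apply: (curve_derivative_dominated (C := 1)) dt'.
  apply: nearW => s; rewrite mul1r -[leRHS]addr0 -null.
  apply: le_trans (ler_nrmD (@ip2C R) (@ip2_lin R) (@ip2_ge0 R) _ _).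
  by rewrite subrKA.
Unshelve. all: by end_near. Qed.

End WholeEvolution.

End SolutionsAsEvolutions.

(** * Second derivatives of the initial data *)

Section InitialData.
Context {R : realType}.
Notation mu := (@lebesgue_measure R).
Notation I01 := (`[0, 1]%classic : set R).
Notation Re := complex.Re.
Notation Im := complex.Im.
Notation L2nrm := (nrm (@ip2 R)).
Hint Resolve measurable01 : core.
Implicit Types (h k : R -> R) (f : R -> R[i]) (x : R).

Lemma near_eq_derive1 h k x : (\near x, h x = k x) -> derive1 h x = derive1 k x.
Proof. by move=> hk; rewrite !derive1E; exact: near_eq_derive. Qed.

Lemma near01 x : 0 < x < 1 -> \forall y \near x, 0 < y < 1.
Proof.
move=> x01; have /near_in_itvoo : x \in `]0, 1[ by rewrite in_itv.
by apply: filterS => y; rewrite in_itv.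
Qed.

Lemma near_eq01 h k x : (forall x, 0 < x < 1 -> h x = k x) -> 0 < x < 1 ->
  \forall y \near x, h y = k y.
Proof. by move=> hk /near01; apply: filterS. Qed.

Lemma eq_derive1n01 n h k : (forall x, 0 < x < 1 -> h x = k x) ->
  forall x, 0 < x < 1 -> derive1n n h x = derive1n n k x.
Proof.
move=> hk; elim: n => [|n IH] x x01; first exact: hk.
by rewrite !derive1nS; apply: near_eq_derive1; exact: near_eq01.
Qed.

Lemma smooth_on_derive_measurable n h : smooth_on (`]0, 1[ : set R) h ->
  measurable_fun (`]0, 1[ : set R) (derive1n n h).
Proof.
move=> [g [U [oU AU hg dg]]].
have sub x : 0 < x < 1 -> U x by move=> x01; apply: AU; rewrite /= in_itv.
have eg : forall x, 0 < x < 1 -> derive1n n h x = derive1n n g x.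
  by apply: eq_derive1n01 => x x01; apply: hg; rewrite /= in_itv.
apply: (@eq_measurable_fun _ _ _ _ _ (derive1n n g)).
  by move=> x; rewrite mem_setE in_itv => /eg.
apply: open_continuous_measurable_fun; first exact: interval_open.
move=> x; rewrite mem_setE in_itv => /sub Ux.
by apply/differentiable_continuous/derivable1_diffP; exact: dg.
Qed.

Lemma derive1_affine_primitive h (F : R -> R) (c d : R) x :
  derivable F x 1 -> derive1 F x = d -> (\near x, h x = c + F x) ->
  derive1 h x = d.
Proof.
move=> dF Fd hF; rewrite (near_eq_derive1 (k := cst c + F) hF) derive1E.
by rewrite deriveD// derive_cst add0r -derive1E.
Qed.

(** The continuous function [k1] is the derivative of [h] at every interior point;
    [k2] is the derivative of [k1] at its Lebesgue points. *)
Lemma derive2_primitive h k1 k2 : integrable01 k2 ->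
  (forall x, 0 <= x <= 1 -> h x = h 0 + prim k1 x /\ k1 x = k1 0 + prim k2 x) ->
  {ae mu, forall x, 0 < x < 1 -> derive1n 2 h x = k2 x}.
Proof.
move=> ik2 hE.
have sub x : 0 < x < 1 -> 0 <= x <= 1 by move=> /andP[? ?]; rewrite !ltW.
pose s y := k1 0 + prim k2 y.
have ks y : 0 <= y <= 1 -> k1 y = s y by move=> /hE[].
have is_ : integrable01 s by exact: slope_integrable.
have dh x : 0 < x < 1 -> derive1 h x = s x.
  move=> x01; have /andP[x0 x1] := x01.
  have cs : {for x, continuous s}.
    apply: cvgD; first exact: cvg_cst.
    have /(continuous_within_itvP _ ltr01)[cc _ _] := prim_continuous ik2.
    by apply: cc; rewrite in_itv.
  have [dF F1] := @continuous_FTC1 _ s (BLeft 0) x 1 x1 is_ x0 cs.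
  apply: (derive1_affine_primitive dF F1); apply: filterS (near01 x01) => y.
  move=> /sub y01; have [-> _] := hE y y01.
  by congr (_ + _); exact: eq_prim.
pose k := k2 \_ I01.
have ik : mu.-integrable setT (EFin \o k) by exact: integrable01_patch.
have lk : locally_integrable setT k by exact: integrable_locally.
have ik0 (y : R) : mu.-integrable [set` Interval (BLeft 0) (BRight y)] (EFin \o k).
  exact: integrableS ik.
have := FTC1 ik0 lk; apply: filterS; first exact: (ae_filter_ringOfSetsType mu).
move=> x Fx x01; have /andP[x0 x1] := x01.
have [dF F1] := Fx x0.
have -> : k2 x = k x by rewrite /k patchE inI01 sub.
rewrite derive1nS.
apply: (derive1_affine_primitive (c := k1 0) dF F1).
apply: filterS (near01 x01) => y y01.
have -> : derive1n 1 h y = s y by exact: dh.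
congr (_ + _).
apply: eq_prim (sub _ y01) _ => z z01.
by rewrite /k patchE inI01 z01.
Qed.

Lemma eq_L2norm f g : (forall x, 0 < x < 1 -> f x = g x) -> L2norm f = L2norm g.
Proof.
move=> fg; rewrite !L2norm_int; congr (_ `^ _)%E; apply: eq_integral => x.
by rewrite mem_setE in_itv => /fg ->.
Qed.

(** This transfers the bound on the classical second derivative of the initial
    datum to the weak second derivative of the solution at time [0]. *)
Lemma L2norm_weak_derivative2 f f2 w : H2_with_derivative2 f f2 ->
  (forall x, 0 < x < 1 -> f x = w x) ->
  smooth_on (`]0, 1[ : set R) (fun x => Re (w x)) ->
  smooth_on (`]0, 1[ : set R) (fun x => Im (w x)) ->
  L2norm (cderive2 w) = L2norm f2.
Proof.
move=> [if2 [f1 fE]] fw swr swi; have [sr si] := inL2_sqint if2.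
have [mr mi _] := if2.
have dr : {ae mu, forall x, 0 < x < 1 ->
    derive1n 2 (fun x => Re (f x)) x = Re (f2 x)}.
  apply: (@derive2_primitive _ (fun x => Re (f1 x))); first exact: sqint_integrable.
  move=> x x01; have [-> ->] := fE x x01.
  by split; [case: (f 0)|case: (f1 0)].
have di : {ae mu, forall x, 0 < x < 1 ->
    derive1n 2 (fun x => Im (f x)) x = Im (f2 x)}.
  apply: (@derive2_primitive _ (fun x => Im (f1 x))); first exact: sqint_integrable.
  move=> x x01; have [-> ->] := fE x x01.
  by split; [case: (f 0)|case: (f1 0)].
have m2 (a b : R -> R) : measurable_fun (`]0, 1[ : set R) a ->
    measurable_fun (`]0, 1[ : set R) b ->
    measurable_fun (`]0, 1[ : set R) (fun x => (a x ^+ 2 + b x ^+ 2)%:E).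
  by move=> ma mb; apply/measurable_EFinP; apply: measurable_funD; exact: measurable_funX.
rewrite !L2norm_int; congr (_ `^ _)%E; apply: ae_eq_integral.
- exact: measurable_itv.
- apply: m2; first exact: (smooth_on_derive_measurable 2 swr).
  exact: (smooth_on_derive_measurable 2 swi).
- exact: m2.
move: dr di; apply: filterS2; first exact: (ae_filter_ringOfSetsType mu).
move=> x hr hi; rewrite /= in_itv/= => x01; rewrite /cderive2 /=.
have er := @eq_derive1n01 2 (fun x => Re (f x)) (fun x => Re (w x)).
have ei := @eq_derive1n01 2 (fun x => Im (f x)) (fun x => Im (w x)).
rewrite /= in er ei hr hi *.
by rewrite -er ?hr// -?ei ?hi// => z z01; rewrite fw.
Qed.

(** ** Multiplication by a bounded function *)

Section Multiplication.
Variables (r : R -> R) (eta : R).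
Hypothesis mr : measurable_fun I01 r.
Hypothesis r_eta : forall x, 0 <= x <= 1 -> `|r x| <= eta.
Implicit Types v w : @L2pair R.

Definition multiply v : @L2pair R :=
  (toL2 (fun x => r x * v.1 x), toL2 (fun x => r x * v.2 x)).

Lemma multiply_sqint (d : @L2fun R) : sqint (fun x => r x * d x).
Proof. by apply: bounded_mul_sqint (L2funP d) => //; exists eta. Qed.

Lemma eta_ge0 : 0 <= eta.
Proof.
by have := @r_eta 0; rewrite lexx ler01 => /(_ isT); exact: le_trans.
Qed.

Lemma le_multiply v : L2nrm (multiply v) <= eta * L2nrm v.
Proof.
apply: (le_nrm_sqr (@ip2C R) (@ip2_ge0 R)); first by rewrite mulr_ge0 ?eta_ge0 ?nrm_ge0.
rewrite exprMn (sqr_nrm (@ip2C R) (@ip2_ge0 R)) /ip2 /= mulrDr.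
have le1 (d : @L2fun R) : L2ip (toL2 (fun x => r x * d x)) (toL2 (fun x => r x * d x))
    <= eta ^+ 2 * L2ip d d.
  have dd := sqint_mul_integrable (L2funP d) (L2funP d).
  rewrite /L2ip toL2E; last exact: multiply_sqint.
  rewrite -RintegralZl//; apply: le_Rintegral => //.
  - by apply: sqint_mul_integrable; exact: multiply_sqint.
  - exact: integrable01Z.
  move=> x; rewrite I01E => x01.
  rewrite mulrACA -!expr2 ler_wpM2r ?sqr_ge0// -(real_normK (num_real (r x))).
  by rewrite ler_pXn2r ?nnegrE ?eta_ge0 ?r_eta.
by rewrite lerD.
Qed.

Lemma schroedinger2_shift (p p' : R -> R) v w :
  (forall x, 0 <= x <= 1 -> p' x = p x + r x) -> schroedinger2 p v w ->
  schroedinger2 p' v (w + multiply v).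
Proof.
move=> pp'.
have shift1 (d e : @L2fun R) : schroedinger p d e ->
    schroedinger p' d (e + toL2 (fun x => r x * d x)).
  move=> [d2 [dd eE]]; exists d2; split=> // x x01.
  rewrite [LHS](_ : _ = e x + toL2 (fun x => r x * d x) x)//.
  by rewrite toL2E ?eE ?pp'//; [ring|exact: multiply_sqint].
by move=> [h1 h2]; split; exact: shift1.
Qed.

End Multiplication.

(** At time [0] the right-hand side is moderate, although no derivative of [q] is
    controlled. *)
Lemma le_schroedinger_image (q : R -> R) (Q : R) f f2 :
  measurable_fun (`]0, 1[ : set R) q -> (forall x, 0 < x < 1 -> `|q x| <= Q) ->
  sqint_pair f -> sqint_pair f2 ->
  L2nrm (toL2pair (schroedinger_image q f f2)) <=
  L2nrm (toL2pair f2) + Q * L2nrm (toL2pair f).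
Proof.
move=> mq qQ sf sf2.
have mp := potential01_measurable mq.
have bp := potential01_bound qQ.
have -> : toL2pair (schroedinger_image q f f2) =
    - toL2pair f2 + multiply (potential01 q) (toL2pair f).
  rewrite -scaleN1r.
  have [_ e] := sqint_pair_lin (-1) sf2 (potential_sqint_pair mq qQ sf).
  transitivity (- 1 *: toL2pair f2 +
    toL2pair (fun x => (potential01 q x)%:C%C * f x)).
    by rewrite -e; congr toL2pair; apply/funext => x; rewrite rmorphN1 mulN1r.
  have [fr fi] := sf.
  congr (_ + _); rewrite /toL2pair /multiply; congr (toL2 _, toL2 _).
    apply/funext => x; rewrite /= toL2E//; case: (f x) => u v /=; ring.
  apply/funext => x; rewrite /= toL2E//; case: (f x) => u v /=; ring.
apply: le_trans (ler_nrmD (@ip2C R) (@ip2_lin R) (@ip2_ge0 R) _ _) _.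
by rewrite (nrmN (@ip2C R) (@ip2_lin R)) lerD2l; exact: le_multiply.
Qed.

End InitialData.

(** * Stability of solutions and uniqueness of very weak solutions *)

Section Stability.
Context {R : realType}.
Notation mu := (@lebesgue_measure R).
Notation I01 := (`[0, 1]%classic : set R).
Notation Re := complex.Re.
Notation Im := complex.Im.
Notation L2nrm := (nrm (@ip2 R)).
Hint Resolve measurable01 : core.

Lemma half_inside (T : R) : 0 < T -> 0 < T / 2 < T.
Proof. by move=> T0; apply/andP; split; lra. Qed.

Lemma sum_sqr_le (n d k : R) : 0 <= n -> n <= d -> 0 <= k ->
  n ^+ 2 + k ^+ 2 <= (d + k) ^+ 2.
Proof. by move=> n0 nd k0; nra. Qed.

Lemma smooth_on_bound (a b : R) (A : set R) (f : R -> R) (M : R) :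
  `]a, b[ `<=` A -> smooth_on A f -> (Linfty_norm A f <= M%:E)%E ->
  forall x : R, a < x < b -> `|f x| <= M.
Proof.
move=> abA sf fM x xab.
have xA : nbhs x A.
  have /near_in_itvoo : x \in `]a, b[ by rewrite in_itv.
  by apply: filterS => y; exact: abA.
exact: Linfty_norm_bound xA (smooth_on_continuous sf xA) fM.
Qed.

Lemma smooth_on_bound_sub (a b : R) (A : set R) (f g : R -> R) (M : R) :
  `]a, b[ `<=` A -> smooth_on A f -> smooth_on A g ->
  (Linfty_norm A (fun x => f x - g x)%R <= M%:E)%E ->
  forall x : R, a < x < b -> `|f x - g x| <= M.
Proof.
move=> abA sf sg fM x xab.
have xA : nbhs x A.
  have /near_in_itvoo : x \in `]a, b[ by rewrite in_itv.
  by apply: filterS => y; exact: abA.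
apply: (Linfty_norm_bound xA _ fM).
by apply: cvgB; [exact: smooth_on_continuous sf xA|exact: smooth_on_continuous sg xA].
Qed.

(** The constants of the second solution enter through the conserved norms of
    [u'] and of its image under the operator, evaluated at time [0]. *)
Lemma solutions_stability (T : R) (a a' q q' : R -> R) (u0 u0' : R -> R[i])
    (u u' : R -> R -> R[i]) (Q1 Q A eta ea M M2 delta : R) :
  0 < T -> solves T a q u0 u -> solves T a' q' u0' u' ->
  smooth_on (`]0, 1[ : set R) q -> smooth_on (`]0, 1[ : set R) q' ->
  smooth_on (`[0, T] : set R) a -> smooth_on (`[0, T] : set R) a' ->
  smooth_on (`]0, 1[ : set R) (fun x => Re (u0' x)) ->
  smooth_on (`]0, 1[ : set R) (fun x => Im (u0' x)) ->
  (Linfty_norm `]0%R, 1%R[ q <= Q1%:E)%E -> (Linfty_norm `]0%R, 1%R[ q' <= Q%:E)%E ->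
  (Linfty_norm `]0%R, 1%R[ (fun x => q x - q' x)%R <= eta%:E)%E ->
  (Linfty_norm `[0%R, T] a <= A%:E)%E ->
  (Linfty_norm `[0%R, T] (fun t => a t - a' t)%R <= ea%:E)%E ->
  (L2norm u0' <= M%:E)%E -> (L2norm (cderive2 u0') <= M2%:E)%E ->
  (L2norm (fun x => u0 x - u0' x)%R <= delta%:E)%E ->
  forall t : R, 0 <= t <= T ->
  (L2norm (fun x => u t x - u' t x)%R <=
   (expR T * (delta + (ea * (M2 + Q * M) + A * eta * M)))%:E)%E.
Proof.
move=> T0 su su' sq sq' sa sa' sr si qQ1 qQ qeta aA aea uM uM2 ud t tT.
have sub01 : (`]0, 1[ : set R) `<=` `]0, 1[ by [].
have sub0T : (`]0, T[ : set R) `<=` `[0, T] by apply: subset_itvW.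
have q1 := smooth_on_bound sub01 sq qQ1.
have q2 := smooth_on_bound sub01 sq' qQ.
have q3 := smooth_on_bound_sub sub01 sq sq' qeta.
have a1 := smooth_on_bound sub0T sa aA.
have a2 := smooth_on_bound_sub sub0T sa sa' aea.
have mq : measurable_fun (`]0, 1[ : set R) q := smooth_on_derive_measurable 0 sq.
have mq' : measurable_fun (`]0, 1[ : set R) q' := smooth_on_derive_measurable 0 sq'.
have md : measurable_fun (`]0, 1[ : set R) (fun x => q x - q' x) by exact: measurable_funB.
have [uxx [Su Hu eu]] := solution_evolves mq q1 su.
have [uxx' [Su' Hu' eu']] := solution_evolves mq' q2 su'.
have [_ [_ [_ [_ _ _ u00 _]]]] := su.
have [_ [_ [_ [_ _ _ u00' _]]]] := su'.
have t00 : 0 <= (0 : R) <= T by rewrite lexx ltW.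
have Q0 : 0 <= Q by exact: (@eta_ge0 _ _ _ (potential01_bound q2)).
have eta0 : 0 <= eta by exact: (@eta_ge0 _ _ _ (potential01_bound q3)).
have shift x : 0 <= x <= 1 -> potential01 q x =
    potential01 q' x + potential01 (fun x => q x - q' x) x.
  by move=> _; rewrite /potential01; case: ifP => _; ring.
have shift' x : 0 <= x <= 1 -> potential01 q' x =
    potential01 q x + potential01 (fun x => q' x - q x) x.
  by move=> _; rewrite /potential01; case: ifP => _; ring.
have mp := potential01_measurable mq; have mp' := potential01_measurable mq'.
have bp := potential01_bound q1; have bp' := potential01_bound q2.
have mdp := potential01_measurable md; have bdp := potential01_bound q3.
have md' : measurable_fun (`]0, 1[ : set R) (fun x => q' x - q x) by exact: measurable_funB.
have bdp' : forall x, 0 <= x <= 1 -> `|potential01 (fun x => q' x - q x) x| <= eta.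
  by apply: potential01_bound => x /q3; rewrite distrC.
have ext f f' : schroedinger2 (potential01 q) f f' ->
    exists f'', schroedinger2 (potential01 q') f f''.
  move=> h; exists (f' + multiply (potential01 (fun x => q' x - q x)) f).
  exact: (schroedinger2_shift (potential01_measurable md') bdp' shift' h).
have [_ Gu' _] := eu'.
pose d s := multiply (potential01 (fun x => q x - q' x)) (toL2pair (u' s)).
have Gd s : 0 <= s <= T -> schroedinger2 (potential01 q) (toL2pair (u' s))
    (toL2pair (schroedinger_image q' (u' s) (uxx' s)) + d s).
  by move=> sT; apply: (schroedinger2_shift mdp bdp shift); exact: Gu'.
have dn s : 0 <= s <= T -> L2nrm (d s) <= eta * L2nrm (toL2pair (u' s)).
  by move=> _; exact: (le_multiply mdp bdp).
have := evolution_stability (@ip2C R) (@ip2_lin R) (@ip2_ge0 R)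
  (@rot_isometry R) (@rot_skew R)
  (@schroedinger2_lin _ _) (schroedinger2_sym mp bp) (@schroedinger2_rot _ _)
  (@schroedinger2_lin _ _) (schroedinger2_sym mp' bp') (@schroedinger2_rot _ _)
  Q0 (schroedinger2_below mp' bp') (schroedinger2_onto mp' bp') ext eu eu' Gd dn a2 a1 tT.
have [[dr di] <-] := sqint_pairB (Su t tT) (Su' t tT).
have [[dr0 di0] <-] := sqint_pairB (Su 0 t00) (Su' 0 t00).
rewrite (L2norm_nrm dr di) lee_fin => En.
have ud0 : L2nrm (toL2pair (fun x => u 0 x - u' 0 x)) <= delta.
  rewrite -lee_fin -L2norm_nrm//; apply: le_trans ud.
  by rewrite le_eqVlt; apply/orP; left; apply/eqP/eq_L2norm => x x01; rewrite u00// u00'.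
have M0 : L2nrm (toL2pair (u' 0)) <= M.
  have [s1 s2] := Su' 0 t00.
  rewrite -lee_fin -L2norm_nrm//; apply: le_trans uM.
  by rewrite le_eqVlt; apply/orP; left; apply/eqP/eq_L2norm.
have M20 : L2nrm (toL2pair (uxx' 0)) <= M2.
  have [iu _] := Hu' 0 t00; rewrite -lee_fin -inL2_norm//; apply: le_trans uM2.
  by rewrite (L2norm_weak_derivative2 (Hu' 0 t00) u00' sr si).
have g0 : L2nrm (toL2pair (schroedinger_image q' (u' 0) (uxx' 0))) <= M2 + Q * M.
  have [iu _] := Hu' 0 t00.
  apply: (le_trans (le_schroedinger_image mq' q2 (Su' 0 t00) (inL2_sqint iu))).
  by rewrite lerD// ler_wpM2l.
have A0 : 0 <= A.
  have h := half_inside T0.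
  exact: le_trans (a1 _ h).
have ea0 : 0 <= ea.
  have h := half_inside T0.
  exact: le_trans (a2 _ h).
set k := ea * _ + _ in En.
have k0 : 0 <= k by rewrite addr_ge0 ?mulr_ge0 ?nrm_ge0.
have kk : k <= ea * (M2 + Q * M) + A * eta * M.
  by rewrite lerD// ler_wpM2l// mulr_ge0.
apply: (@le_trans _ _ (expR T * (delta + k))); last first.
  by rewrite ler_wpM2l ?expR_ge0// lerD2l.
have delta0 : 0 <= delta by exact: le_trans (nrm_ge0 _ _) ud0.
have e1 : 1 <= expR T by rewrite -expR0 ler_expR ltW.
have et : expR t <= expR T by rewrite ler_expR; case/andP: tT.
apply: (le_nrm_sqr (@ip2C R) (@ip2_ge0 R)).
  by apply: mulr_ge0; [exact: expR_ge0|exact: addr_ge0].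
apply: (le_trans En); rewrite exprMn.
apply: ler_pM; rewrite ?expR_ge0//.
- by rewrite addr_ge0 ?ip2_ge0 ?sqr_ge0.
- by rewrite (le_trans et)// expr2 ler_peMl ?expR_ge0.
rewrite -(sqr_nrm (@ip2C R) (@ip2_ge0 R)).
move: (L2nrm _) (nrm_ge0 _ _ : 0 <= L2nrm (toL2pair (fun x => u 0 x - u' 0 x))) ud0.
by move=> n n0 nd; exact: sum_sqr_le.
Qed.

End Stability.

(** The exponent of negligibility is raised by the exponents of moderateness,
    which absorbs every negative power of [e]. *)
Lemma moderate_times_negligible (R : realType) (e : R) (N Na Nq N0 K : nat)
    (Ca Cq C0 Da Dq D0 : R) :
  0 < e <= 1 -> 0 <= Ca -> 0 <= Cq -> 0 <= C0 -> 0 <= Da -> 0 <= Dq -> 0 <= D0 ->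
  K = (N + (Na + Nq + N0))%N ->
  D0 * e ^+ K + (Da * e ^+ K * (C0 * e ^- N0 + Cq * e ^- Nq * (C0 * e ^- N0)) +
    Ca * e ^- Na * (Dq * e ^+ K) * (C0 * e ^- N0))
  <= (D0 + (Da * (C0 + Cq * C0) + Ca * Dq * C0)) * e ^+ N.
Proof.
move=> /andP[e0 e1] Ca0 Cq0 C00 Da0 Dq0 D00 ->.
have e0' := ltW e0.
have pw n : 0 <= e ^+ n <= 1 by rewrite exprn_ge0// exprn_ile1.
have pn n : e ^+ n != 0 by rewrite expf_neq0// gt_eqF.
have -> : e ^+ (N + (Na + Nq + N0)) = e ^+ N * (e ^+ Na * e ^+ Nq * e ^+ N0) by rewrite -!exprD.
move: (pn Na) (pn Nq) (pn N0) (pw Na) (pw Nq) (pw N0) (pw N).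
move: (e ^+ Na) (e ^+ Nq) (e ^+ N0) (e ^+ N) => x y z w x0 y0 z0.
move=> /andP[xp x1] /andP[yp y1] /andP[zp z1] /andP[wp _].
rewrite [leLHS](_ : _ = (D0 * (x * y * z) + (Da * (x * y * C0 + x * (Cq * C0)) +
   Ca * Dq * C0 * y)) * w); last by field; rewrite x0 y0 z0.
rewrite ler_wpM2r// lerD//.
  by rewrite ler_piMr// mulr_ile1 ?mulr_ge0// mulr_ile1.
rewrite lerD//; last by rewrite ler_piMr ?mulr_ge0.
rewrite ler_wpM2l// lerD//.
  by rewrite ler_piMl// mulr_ile1.
by rewrite ler_piMl ?mulr_ge0.
Qed.

Theorem theorem3p8 (R : realType) (T : R) (hT : 0 < T)
    (q : schwartz_distribution (`]0, 1[ : set R)) (u0 : complex_schwartz_distribution (`]0, 1[ : set R))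
    (a : schwartz_distribution (`[0, T] : set R))
    (hq : dist_ge q 0)
    (ha : exists a0 : R, 0 < a0 /\ dist_ge a a0) :
  unique_very_weak_solution q a u0.
Proof.
move=> qe qe' ae ae' u0e u0e' u u' [sq _] [sq' _] [N1 [C1 C10 qC1]] [Nq [Cq Cq0 qCq]].
move=> qneg [sa _] [sa' _] [Na [Ca Ca0 aCa]] _ aneg _ [[sr _] [si _]] _.
move=> [N0 [C0 C00 uC0]] [uneg _] su su' N.
pose K := (N + (Na + Nq + N0))%N.
have [Dq Dq0 qDq] := qneg K.
have [Da Da0 aDa] := aneg K.
have [D0 D00 uD0] := uneg K.
exists (expR T * (D0 + (Da * (C0 + Cq * C0) + Ca * Dq * C0))).
  rewrite mulr_gt0 ?expR_gt0// addr_gt0// addr_gt0 ?mulr_gt0//.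
  by rewrite addr_gt0 ?mulr_gt0.
move=> e t e01 tT.
have [uM uM2] := uC0 e e01.
apply: (le_trans (solutions_stability hT (su e e01) (su' e e01) (sq e e01)
  (sq' e e01) (sa e e01) (sa' e e01) (sr e e01) (si e e01) (qC1 e e01) (qCq e e01)
  (qDq e e01) (aCa e e01) (aDa e e01) uM uM2 (uD0 e e01) tT)).
rewrite lee_fin -[leRHS]mulrA ler_wpM2l ?expR_ge0//.
by apply: moderate_times_negligible; rewrite // ltW.
Qed.
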